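(* Let $h_k(z)=\sum_{n\ge1}\alpha_k(n)q^n$ ($k\ge 2$) be as in the context, and let $A(n)=\sum_{j=0}^{n}\binom{n}{j}^2\binom{n+j}{j}$ be the Apéry numbers. Then for any prime $p\ge 5$ and integer $r\ge 1$, $$A\left(\frac{p^r-1}{2}\right) \equiv \alpha_{2r+1}(p) \pmod{p^2}.$$
   Context: For each integer $k\ge 2$, $h_k(z)=\sum_{n\ge1}\alpha_k(n)q^n$ is a weight $k$ newform with complex multiplication by $\mathbb{Q}(\sqrt{-1})$ (such forms are known to exist) whose coefficients at odd primes $p$ are: $\alpha_k(p)=(-1)^{\frac{(x+y-1)(k-1)}{2}}\left[(x+iy)^{k-1}+(x-iy)^{k-1}\right]$ if $p\equiv 1\pmod 4$, where $p=x^2+y^2$ with integers $x,y$, $x$ odd; and $\alpha_k(p)=0$ if $p\equiv 3\pmod 4$. In particular $h_3(z)=q\prod_{n\ge1}(1-q^{4n})^6$, the unique newform in $S_3(\Gamma_0(16),(\tfrac{-4}{\cdot}))$. *)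

(* Defs.v *)
From HB Require Import structures.
From mathcomp Require Import all_boot all_order all_algebra.
From mathcomp Require Import complex.
From mathcomp Require Import all_classical all_reals all_analysis.
Set Implicit Arguments.
Unset Strict Implicit.
Unset Printing Implicit Defensive.
Import Order.TTheory GRing.Theory Num.Theory.
Import numFieldNormedType.Exports.
Local Open Scope classical_set_scope.
Local Open Scope ring_scope.
Local Open Scope complex_scope.

Section ModularForms.
Variable R : realType.
Local Notation C := R[i].

(* Forms are total functions on C of which only the values on the upper
   half-plane matter. *)
Definition upper_half : set C := [set z | 0 < complex.Im z].

(* e^(2 pi i z) *)
Definition qexp (z : C) : C :=
  (expR (- (2 * pi * complex.Im z)) * cos (2 * pi * complex.Re z))
  +i* (expR (- (2 * pi * complex.Im z)) * sin (2 * pi * complex.Re z)).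

(* Complex differentiability: C is a normed space over itself here, and the
   derivative is taken in the direction 1. *)
Definition holomorphic_upper (f : C -> C) : Prop :=
  forall z : C, upper_half z -> derivable (f : C^o -> C^o) z 1.

Definition SL2Z : set 'M[int]_2 := [set g | \det g = 1].

Definition Gamma0 (N : nat) : set 'M[int]_2 :=
  [set g | SL2Z g /\ (N%:Z %| g 1%R 0%R)%Z].

Definition cocycle (g : 'M[int]_2) (z : C) : C :=
  (g 1 0)%:~R * z + (g 1 1)%:~R.

Definition moebius (g : 'M[int]_2) (z : C) : C :=
  ((g 0 0)%:~R * z + (g 0 1)%:~R) / cocycle g z.

Definition slash (k : nat) (f : C -> C) (g : 'M[int]_2) (z : C) : C :=
  cocycle g z ^- k * f (moebius g z).

Definition dirichlet_char (N : nat) (chi : int -> C) : Prop :=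
  [/\ forall a b, chi (a * b) = chi a * chi b,
      forall a, chi (a + N%:Z) = chi a
    & forall a, (chi a != 0) = coprimez a N].

(* S_k(Gamma0(N), chi) *)
Definition cusp_form (k N : nat) (chi : int -> C) (f : C -> C) : Prop :=
  [/\ holomorphic_upper f,
      forall g z, Gamma0 N g -> upper_half z ->
        slash k f g z = chi (g 1 1) * f z
    & forall g, SL2Z g -> forall eps : R, 0 < eps ->
        exists Y : R, forall z : C, upper_half z -> Y < complex.Im z ->
          `|slash k f g z| < eps%:C].

(* T_n f = n^(k-1) sum_(ad = n) chi(a) d^(-k) sum_(0 <= b < d) f((az+b)/d) *)
Definition hecke (k : nat) (chi : int -> C) (n : nat) (f : C -> C) (z : C)
    : C :=
  n%:R ^+ k.-1 *
  \sum_(d <- divisors n) chi (n %/ d)%:Z * d%:R ^- k *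
    \sum_(b < d) f (((n %/ d)%:R * z + b%:R) / d%:R).

(* A Borel set of representatives of Gamma0(N) \ H, with C seen as R * R. *)
Definition fundamental_set (N : nat) (F : set (R * R)) : Prop :=
  [/\ measurable F,
      forall u, F u -> upper_half (u.1 +i* u.2)
    & forall z, upper_half z ->
        exists! u, F u /\
          exists g, Gamma0 N g /\ u.1 +i* u.2 = moebius g z].

(* The Petersson product, up to the usual positive normalisation; for f and g
   in the same S_k(Gamma0(N), chi) it does not depend on the fundamental set. *)
Definition petersson (k : nat) (F : set (R * R)) (f g : C -> C) : C :=
  let w (u : R * R) : C :=
    f (u.1 +i* u.2) * (g (u.1 +i* u.2))^* * (u.2 ^+ k / u.2 ^+ 2)%:C in
  (\int[(@lebesgue_measure R \x @lebesgue_measure R)%E]_(u in F)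
     complex.Re (w u))
  +i* (\int[(@lebesgue_measure R \x @lebesgue_measure R)%E]_(u in F)
     complex.Im (w u)).

(* Orthogonality to all the generators z |-> g(dz) of the space of oldforms,
   where g has level M properly dividing N and d divides N / M. *)
Definition orthogonal_to_oldforms (k N : nat) (chi : int -> C) (f : C -> C)
    : Prop :=
  forall (M d : nat) (psi : int -> C) (g : C -> C),
    (M %| N)%N -> (M < N)%N -> (d %| N %/ M)%N ->
    dirichlet_char M psi ->
    (forall a, coprimez a N -> psi a = chi a) ->
    cusp_form k M psi g ->
    forall F, fundamental_set N F ->
      petersson k F f (fun z => g (d%:R * z)) = 0.

Definition q_expansion (f : C -> C) (a : nat -> C) : Prop :=
  forall z : C, upper_half z ->
    (fun m : nat => \sum_(1 <= n < m) a n * qexp z ^+ n : C^o) @ \oo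
      --> (f z : C^o).

(* f = sum_(n >= 1) a(n) q^n is a newform of weight k (of some level and
   nebentypus): a cusp form in the new subspace, eigenvector of all the Hecke
   operators, normalised by a(1) = 1. *)
Definition newform (k : nat) (f : C -> C) (a : nat -> C) : Prop :=
  exists (N : nat) (chi : int -> C),
    [/\ (0 < N)%N, dirichlet_char N chi & cusp_form k N chi f] /\
    [/\ orthogonal_to_oldforms k N chi f,
        forall n, (0 < n)%N -> exists lam : C,
          forall z, upper_half z -> hecke k chi n f z = lam * f z,
        q_expansion f a
      & a 1%N = 1].

(* The quadratic character (-4/.) of Q(sqrt(-1)). *)
Definition chi_m4 (n : nat) : C :=
  if (n %% 4 == 1)%N then 1 else if (n %% 4 == 3)%N then -1 else 0.

(* Complex multiplication by Q(sqrt(-1)): a(p) is unchanged by the twist by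
   (-4/.), for almost all primes p. *)
Definition CM_by_Qi (a : nat -> C) : Prop :=
  exists B : nat, forall p : nat, prime p -> (B < p)%N ->
    chi_m4 p * a p = a p.

(* The sign exponent is an integer since x + y is odd, and the formula does
   not depend on the choice of (x, y). *)
Definition CM_coefficients (k : nat) (a : nat -> C) : Prop :=
  forall p : nat, prime p -> odd p ->
    ((p %% 4)%N = 1%N ->
       forall x y : int, p%:Z = x ^+ 2 + y ^+ 2 -> ~~ (2 %| x)%Z ->
         a p = (-1) ^ (((x + y - 1) * (k%:Z - 1)) %/ 2)%Z *
               ((x%:~R +i* y%:~R) ^+ (k - 1) + (x%:~R -i* y%:~R) ^+ (k - 1)))
    /\ ((p %% 4)%N = 3%N -> a p = 0).

Definition is_h (k : nat) (f : C -> C) (a : nat -> C) : Prop :=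
  [/\ newform k f a, CM_by_Qi a & CM_coefficients k a].

(* Congruence modulo m Z inside C. *)
Definition congruent_mod (m : nat) (u v : C) : Prop :=
  exists c : int, u - v = (c * m%:Z)%:~R.

End ModularForms.

Definition Apery (n : nat) : nat :=
  (\sum_(0 <= j < n.+1) 'C(n, j) ^ 2 * 'C(n + j, j))%N.

(* Main.v *)
Require Import Defs.
From mathcomp Require Import all_boot all_order all_algebra.
From mathcomp Require Import complex.
From mathcomp Require Import all_classical all_reals all_analysis.
From mathcomp Require Import finfield zify ring lra.
Set Implicit Arguments.
Unset Strict Implicit.
Unset Printing Implicit Defensive.
Import Order.TTheory GRing.Theory Num.Theory.
Local Open Scope ring_scope.

(* Write [m = (p - 1) / 2] and compute in [Z/p^2], where [1 + p x] behaves like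
   an exponential: ['C(m + s, s) = (-1)^s 'C(m, s) (1 - p (H_m - H_(m-s)))].
   Comparing the Apery sum with its reflection
   [A(m) = (-1)^m sum_s (-1)^s 'C(m, s) 'C(m + s, s)^2] kills the first order
   terms, so [A(m) = sum_s (-1)^s 'C(m, s)^3], which is [0] for [m] odd and is
   given by Dixon's identity for [m] even.  The same vanishing turns Gessel's
   congruence for [A(p N + m)] into [A(p N + m) = A(N) A(m)], whence
   [A((p^r - 1) / 2) = A(m)^r].

   Let [p = 4n + 1].  Through the Teichmuller character, the Jacobi sum
   [J = sum_x w(x)^(3n) w(1-x)^(2n)] and its conjugate become [a - b I] and
   [a + b I] in [Z/p^2], with [I^2 = -1] and integers [a] odd and [b] even.
   The expansion [(1 - t)^p = 1 - t - p sum_k t^k / k] evaluates both: the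
   conjugate is divisible by [p], their product is [p], and [J^2 = A(m)].  As
   [a^2 + b^2 < p^2], the product gives [a^2 + b^2 = p], and since the conjugate
   has square [0], [(a + b I)^(2r) + (a - b I)^(2r) = J^(2r) = A(m)^r]. *)

(** * Finite differences of binomials and the reflected Apery sum *)

(** The [M]-th finite difference lowers the lower index of a binomial coefficient by [M]; induction
    on [M] by Pascal's rule. *)
Lemma alt_sum_bin (M x k : nat) :
  \sum_(t < M.+1) (-1) ^+ t * 'C(M, t)%:R * 'C(x + t, k + M)%:R
    = (-1) ^+ M * 'C(x, k)%:R :> int.
Proof.
elim: M x k => [|M IH] x k; first by rewrite big_ord1 !addn0 bin0 mulr1.
rewrite big_ord_recl /= bin0 addn0 mulr1 expr0 mul1r.
under eq_bigr => i _ do rewrite /bump /= add1n binS natrD exprS mulrDr mulrDl.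
rewrite big_split /= addrA.
have -> : 'C(x, k + M.+1)%:R + \sum_(i < M.+1)
    -1 * (-1) ^+ i * 'C(M, i.+1)%:R * 'C(x + i.+1, k + M.+1)%:R
    = \sum_(t < M.+1) (-1) ^+ t * 'C(M, t)%:R * 'C(x + t, k.+1 + M)%:R :> int.
  rewrite [in RHS]big_ord_recl [in LHS]big_ord_recr /= bin0 [in 'C(M, M.+1)]bin_small //.
  rewrite mulr0 mul0r addr0 expr0 !mul1r addn0 addSnnS; congr (_ + _).
  by apply: eq_bigr => i _; rewrite /bump /= add1n exprS.
have -> : \sum_(i < M.+1)
    -1 * (-1) ^+ i * 'C(M, i)%:R * 'C(x + i.+1, k + M.+1)%:R
    = - \sum_(t < M.+1) (-1) ^+ t * 'C(M, t)%:R * 'C(x.+1 + t, k.+1 + M)%:R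
    :> int.
  rewrite -sumrN; apply: eq_bigr => i _.
  by rewrite addSnnS addSnnS; ring.
by rewrite !IH binS natrD exprS; ring.
Qed.

(** One factor ['C(n + s, s)] expands by Vandermonde into a sum over [i]; after exchanging the sums,
    the alternating sum over [s] is a finite difference. *)
Lemma apery_reflection (n : nat) :
  \sum_(j < n.+1) ('C(n, j) ^ 2 * 'C(n + j, j))%:R
    = (-1) ^+ n * \sum_(s < n.+1) (-1) ^+ s * 'C(n, s)%:R * 'C(n + s, s)%:R ^+ 2
    :> int.
Proof.
have exp s : 'C(n + s, s)%:R = \sum_(i < n.+1) 'C(n, i)%:R * 'C(s, i)%:R :> int.
  rewrite -[s in 'C(_, s)](addKn n s) bin_sub ?leq_addr // addnC.
  rewrite -binomial.Vandermonde natr_sum; apply: eq_bigr => i _.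
  by rewrite natrM mulrC bin_sub // -ltnS.
under [in RHS]eq_bigr => s _ do rewrite expr2 {2}exp mulrA mulr_sumr.
rewrite exchange_big mulr_sumr /=; apply: eq_bigr => -[i /= lein] _.
rewrite ltnS in lein.
transitivity ((-1) ^+ n * 'C(n, i)%:R ^+ 2 * ((-1) ^+ i *
   \sum_(t < (n - i).+1) (-1) ^+ t * 'C(n - i, t)%:R
     * 'C(n + i + t, i + (n - i))%:R : int)).
  rewrite alt_sum_bin natrM natrX.
  have -> : (-1) ^+ i * ((-1) ^+ (n - i) * 'C(n + i, i)%:R)
    = (-1) ^+ n * 'C(n + i, i)%:R :> int by rewrite mulrA -exprD subnKC.
  by rewrite mulrACA -exprD -signr_odd oddD addbb mul1r.
rewrite -mulrA; congr (_ * _).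
rewrite -(big_mkord predT (fun s => (-1) ^+ s * 'C(n, s)%:R * 'C(n + s, s)%:R *
  ('C(n, i)%:R * 'C(s, i)%:R) : int)).
have lein1 : (i <= n.+1)%N by rewrite leqW.
(* ['C(s, i)] vanishes for [s < i], so the sum is reindexed by [t = s - i]. *)
rewrite (big_cat_nat (leq0n i) lein1) /= [X in _ = X + _]big_nat_cond.
rewrite [X in _ = X + _]big1 => [|s /andP[lt_si _]]; last first.
  by rewrite ['C(s, i)]bin_small ?mulr0.
rewrite add0r -[X in \sum_(X <= _ < _) _]add0n big_addn big_mkord.
rewrite subSn // mulrA !mulr_sumr.
apply: eq_bigr => -[t /= lt_t] _; rewrite ltnS in lt_t.
have le_tin : (t + i <= n)%N by lia.
have E : ('C(n, t + i) * 'C(t + i, i) = 'C(n, i) * 'C(n - i, t))%N.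
  apply/eqP; rewrite -(eqn_pmul2r (fact_gt0 i)) -(eqn_pmul2r (fact_gt0 t)).
  rewrite -(eqn_pmul2r (fact_gt0 (n - (t + i)))).
  have := bin_fact le_tin; have := @bin_fact (t+i) i ltac:(lia).
  have := @bin_fact n i lein; have := @bin_fact (n - i) t lt_t.
  rewrite addnK (_ : n - i - t = n - (t + i))%N; last by lia.
  by nia.
have -> : 'C(n + i + t, i + (n - i)) = 'C(n + (t + i), t + i).
  by rewrite subnKC // -addnA (addnC i) -[in RHS]bin_sub ?leq_addl // addnK.
move/(congr1 (fun k => k%:R : int)): E; rewrite !natrM exprD => E.
transitivity ((-1) ^+ t * (-1) ^+ i * 'C(n + (t + i), t + i)%:R * 'C(n, i)%:R *
  ('C(n, i)%:R * 'C(n - i, t)%:R) : int); first by ring.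
by rewrite -E; ring.
Qed.

(** * Dixon's identity by the Wilf-Zeilberger method *)

Lemma subr_binS (x k : nat) :
  'C(x.+1, k.+1)%:R - 'C(x, k.+1)%:R = 'C(x, k)%:R :> int.
Proof. by rewrite binS natrD; ring. Qed.

Lemma mul_bin_pascal (x k : nat) :
  k%:R * 'C(x, k)%:R = (x%:R + 1 - k%:R) * ('C(x.+1, k)%:R - 'C(x, k)%:R) :> int.
Proof.
case: k => [|k]; first by rewrite !bin0 subrr mulr0 mul0r.
rewrite subr_binS -natrM mul_bin_left natrM.
by case: (leqP k x) => h; [rewrite natrB //; ring | rewrite bin_small // !mulr0].
Qed.

(* The Wilf-Zeilberger certificate is
   [- (-1) ^+ s * s * 'C(2N, s) * 'C(x, s - 1) * 'C(x, 2N - s) / 2]. *)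
Lemma dixon_step (x N : nat) :
  let h y := \sum_(s < (2 * N).+1)
    (-1) ^+ s * 'C(2 * N, s)%:R * ('C(y, s)%:R * 'C(y, 2 * N - s)%:R) : int in
  (x%:R + 1 - N%:R) * h x.+1 = (x%:R + 1 + N%:R) * h x.
Proof.
move=> h; apply/eqP; rewrite -subr_eq0; apply/eqP.
pose g s : int := - ((-1) ^+ s * s%:R * 'C(2 * N, s)%:R *
  (('C(x.+1, s)%:R - 'C(x, s)%:R) * 'C(x, 2 * N - s)%:R)).
have two_neq0 : 2 != 0 :> int by [].
apply: (mulfI two_neq0); rewrite mulr0 mulrBr /h !mulr_sumr -sumrB.
transitivity (\sum_(s < (2 * N).+1) (g s.+1 - g s)); last first.
  rewrite -(big_mkord predT (fun s => g s.+1 - g s)) telescope_sumr // /g.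
  by rewrite mulr0 [in 'C(2 * N, _.+1)]bin_small // mulr0 !mul0r oppr0 subrr.
apply: eq_bigr => -[s /= le_s] _; rewrite ltnS in le_s.
have {}gE : g s.+1 = (-1) ^+ s * 'C(2 * N, s)%:R * ((2 * N%:R - s%:R) *
    ('C(x, s)%:R * ('C(x.+1, 2 * N - s)%:R - 'C(x, 2 * N - s)%:R))).
  have e1 : s.+1%:R * 'C(2 * N, s.+1)%:R = (2 * N%:R - s%:R) * 'C(2 * N, s)%:R
    :> int by rewrite -natrM mul_bin_left natrM natrB // natrM.
  rewrite /g exprS -[_ * s.+1%:R * _]mulrA e1 subr_binS.
  move: le_s; rewrite leq_eqVlt => /predU1P[-> | lt_s].
    by rewrite natrM; ring.
  have [k Ek] : exists k, (2 * N - s = k.+1)%N by exists (2 * N - s).-1; lia.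
  have -> : (2 * N - s.+1 = k)%N by lia.
  by rewrite Ek subr_binS; ring.
rewrite gE /g.
have := mul_bin_pascal x s; have := mul_bin_pascal x (2 * N - s).
rewrite natrB // natrM.
set P' : int := 'C(x.+1, s)%:R; set Q' : int := 'C(x.+1, _)%:R.
set P : int := 'C(x, s)%:R; set Q : int := 'C(x, _)%:R.
set c : int := 'C(_, _)%:R; set e : int := _ ^+ s.
move: P P' Q Q' c e => P P' Q Q' c e eQ eP.
apply/eqP; rewrite -subr_eq0; apply/eqP.
(* The expression is a combination, with these multipliers, of the two instances of [mul_bin_pascal]
   at the lower indices [s] and [2N - s]. *)
transitivity (e * c * (
   (s%:R * P - (x%:R + 1 - s%:R) * (P' - P)) * (- 2 * Q)
 + ((2 * N%:R - s%:R) * Q - (x%:R + 1 - (2 * N%:R - s%:R)) * (Q' - Q)) * (-2 * P)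
 - (s%:R * P - (x%:R + 1 - s%:R) * (P' - P)) * (Q' - Q)
 - ((2 * N%:R - s%:R) * Q - (x%:R + 1 - (2 * N%:R - s%:R)) * (Q' - Q)) * (P' - P))).
  by ring.
by rewrite eQ eP !subrr; ring.
Qed.

(** Induction on [d] through [dixon_step] at [x = N + d]; for [d = 0] only [s = N] contributes. The
    case [d = N] is the sum of [(-1)^s 'C(2N, s)^3]. *)
Lemma dixon (N d : nat) :
  \sum_(s < (2 * N).+1)
    (-1) ^+ s * 'C(2 * N, s)%:R * ('C(N + d, s)%:R * 'C(N + d, 2 * N - s)%:R)
  = (-1) ^+ N * ('C(2 * N + d, d) * 'C(2 * N, N))%:R :> int.
Proof.
elim: d => [|d IH].
  have ltN : (N < (2 * N).+1)%N by lia.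
  rewrite (bigD1 (Ordinal ltN)) //= big1 => [|[s /= lt_s]]; last first.
    rewrite -val_eqE /= => neq; rewrite !addn0.
    have [lt_sN | lt_Ns] : (s < N \/ N < s)%N by lia.
      by rewrite ['C(N, 2 * N - s)]bin_small ?mulr0 //; lia.
    by rewrite ['C(N, s)]bin_small ?mul0r ?mulr0.
  rewrite addn0 (_ : (2 * N - N = N)%N) ?binn ?bin0; last by lia.
  by rewrite natrM; ring.
have nz : (d%:R + 1 : int) != 0 by lia.
apply: (mulfI nz).
have := dixon_step (N + d) N; rewrite /= IH -addnS natrD.
rewrite (_ : N%:R + d%:R + 1 - N%:R = d%:R + 1 :> int); last by ring.
move=> ->.
have /(congr1 (fun k => k%:R : int)) := mul_bin_diag (2 * N + d.+1) d.
rewrite addnS /= !natrM => E.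
transitivity ((-1) ^+ N * ((2 * N + d).+1%:R * 'C(2 * N + d, d)%:R)
  * 'C(2 * N, N)%:R : int).
  by rewrite -natr1 natrD natrM; ring.
by rewrite E -[d.+1%:R]natr1; ring.
Qed.

(** * Alternating sums of reciprocals over the rationals *)

Lemma fact_neq0 (n : nat) : n`!%:R != 0 :> rat.
Proof. by rewrite pnatr_eq0 -lt0n fact_gt0. Qed.

Ltac pos_neq0 :=
  repeat (apply/andP; split); try done; apply: lt0r_neq0; lra.

(** The beta integral of [t^x (1 - t)^N] over [[0, 1]]; Pascal's rule gives
    [S(N+1, x) = S(N, x) - S(N, x+1)]. *)
Lemma sum_inv_bin (N x : nat) :
  \sum_(l < N.+1) (-1) ^+ l * 'C(N, l)%:R / (x + l).+1%:R
    = (N`! * x`!)%:R / (x + N).+1`!%:R :> rat.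
Proof.
elim: N x => [|N IH] x.
  rewrite big_ord1 !addn0 bin0 fact0 mul1n factS natrM expr0 -natr1.
  have : (0 <= x%:R :> rat) by [].
  have := fact_neq0 x => a0 X0.
  by field; pos_neq0.
rewrite big_ord_recl /= bin0 addn0 mulr1 expr0.
under eq_bigr => i _ do rewrite /bump /= add1n binS natrD exprS mulrDr mulrDl.
rewrite big_split /= addrA.
have -> : 1 / x.+1%:R + \sum_(i < N.+1)
    -1 * (-1) ^+ i * 'C(N, i.+1)%:R / (x + i.+1).+1%:R
    = \sum_(t < N.+1) (-1) ^+ t * 'C(N, t)%:R / (x + t).+1%:R :> rat.
  rewrite [in RHS]big_ord_recl [in LHS]big_ord_recr /= bin0 bin_small //.
  rewrite mulr0 mul0r addr0 expr0 mul1r addn0; congr (_ + _); first by rewrite !mul1r.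
  by apply: eq_bigr => i _; rewrite /bump /= add1n exprS.
have -> : \sum_(i < N.+1) -1 * (-1) ^+ i * 'C(N, i)%:R / (x + i.+1).+1%:R
    = - \sum_(t < N.+1) (-1) ^+ t * 'C(N, t)%:R / (x.+1 + t).+1%:R :> rat.
  by rewrite -sumrN; apply: eq_bigr => i _; rewrite addSnnS; ring.
rewrite !IH addSnnS addnS !factS !natrM -!natr1 !natrD.
have := fact_neq0 (x + N); have : (0 <= x%:R :> rat) by [].
have : (0 <= N%:R :> rat) by [].
move=> M0 X0 c0.
by field; pos_neq0.
Qed.

(** Taken over any unit ring, to serve both in [rat] and modulo [p^2], where all the inverses are
    genuine for [n < p]. *)
Definition harmonic_sum (R : unitRingType) (n : nat) : R :=
  \sum_(i < n) i.+1%:R^-1.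

Lemma harmonicS (R : unitRingType) (n : nat) :
  harmonic_sum R n.+1 = harmonic_sum R n + n.+1%:R^-1.
Proof. exact: big_ord_recr. Qed.

Lemma alt_sum_fact (n : nat) :
  \sum_(k < n.+1) (-1) ^+ k / k.+1%:R
     * (n`!%:R * n.+1`!%:R / ((n - k)`!%:R * (n.+1 + k)`!%:R))
  = harmonic_sum rat (2 * n.+1) - harmonic_sum rat n.+1 + (2 * n.+1)%:R^-1.
Proof.
elim: n => [|n IH]; first by rewrite big_ord1 /harmonic_sum !big_ord_recl !big_ord0.
pose F k : rat := (-1) ^+ k / k.+1%:R
     * (n`!%:R * n.+1`!%:R / ((n - k)`!%:R * (n.+1 + k)`!%:R)).
(* Wilf-Zeilberger certificate: for [k <= n] the summand for [n.+1] exceeds [F k] by [g k.+1 - g k].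
   The term [k = n.+1] is treated apart, as there [n - k] truncates. *)
pose g k : rat := (-1) ^+ k / 2
  * ((n.+1%:R / (2 * n.+1%:R + 1) - k%:R) / n.+1%:R
     * (n.+1`!%:R * n`!%:R / ((n.+1 - k)`!%:R * (n.+1 + k)`!%:R))).
have n0 : n.+1%:R != 0 :> rat by rewrite pnatr_eq0.
have step k : (k < n.+1)%N -> (-1) ^+ k / k.+1%:R *
    (n.+1`!%:R * n.+2`!%:R / ((n.+1 - k)`!%:R * (n.+2 + k)`!%:R))
    = F k + (g k.+1 - g k).
  rewrite ltnS /F /g => /subnKC <-; set d := (n - k)%N.
  have -> : ((k + d).+1 - k = d.+1)%N by lia.
  have -> : (k + d - k = d)%N by lia.
  have -> : ((k + d).+1 - k.+1 = d)%N by lia.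
  have -> : ((k + d).+1 + k.+1 = (k + d + k).+2)%N by lia.
  have -> : ((k + d).+2 + k = (k + d + k).+2)%N by lia.
  have -> : ((k + d).+1 + k = (k + d + k).+1)%N by lia.
  have := fact_neq0 (k + d); have := fact_neq0 (k + d + k).
  have := fact_neq0 d; have : (0 <= k%:R :> rat) by []; have : (0 <= d%:R :> rat) by [].
  rewrite !factS exprS !natrM -!natr1 !natrD.
  by move=> D0 K0 c0 b0 a0; field; pos_neq0.
rewrite big_ord_recr /=; under eq_bigr => k _ do rewrite step //.
rewrite big_split /= IH -(big_mkord predT (fun k => g k.+1 - g k)).
rewrite telescope_sumr // /g.
have -> : (2 * n.+2 = (2 * n.+1).+2)%N by lia.
rewrite (harmonicS _ (2 * n.+1).+1) (harmonicS _ (2 * n.+1)) (harmonicS _ n.+1).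
rewrite !subnn subn0 addn0.
have -> : (n.+2 + n.+1 = (2 * n.+1).+1)%N by lia.
have -> : (n.+1 + n.+1 = 2 * n.+1)%N by lia.
have : (2 * n.+1)%:R = 2 * (n%:R + 1) :> rat by rewrite natrM natr1.
have := fact_neq0 n; have := fact_neq0 (2 * n.+1).
have : (0 <= n%:R :> rat) by [].
move: (2 * n.+1)%N => M N0 b0 a0 eM.
rewrite !factS fact0 expr0 !natrM -!natr1 eM.
by field; pos_neq0.
Qed.

(** The identity [alt_sum_fact] at [n - 1], with the factorials gathered into the binomials that
    occur in the first-order part of a Jacobi sum. *)
Lemma alt_sum_central_bin (n : nat) : (0 < n)%N ->
  2 * \sum_(k < n) (-1) ^+ k * 'C((2 * n).-1, n - k.+1)%:R / k.+1%:R
  = 'C(2 * n, n)%:R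
    * (harmonic_sum rat (2 * n) - harmonic_sum rat n + (2 * n)%:R^-1).
Proof.
case: n => // n _; rewrite -alt_sum_fact !mulr_sumr; apply: eq_bigr => k _.
have lekn : (k <= n)%N by rewrite -ltnS.
rewrite subSS.
have eC : 'C((2 * n.+1).-1, n - k)%:R
    = (2 * n.+1).-1`!%:R / ((n - k)`!%:R * (n.+1 + k)`!%:R) :> rat.
  apply: canRL (mulfK _) _; first by rewrite mulf_neq0 ?fact_neq0.
  rewrite -!natrM -(@bin_fact (2 * n.+1).-1 (n - k)); last by lia.
  by congr (_ * (_ * _`!))%:R; lia.
have eD : 'C(2 * n.+1, n.+1)%:R
    = (2 * n.+1)`!%:R / (n.+1`!%:R * n.+1`!%:R) :> rat.
  apply: canRL (mulfK _) _; first by rewrite mulf_neq0 ?fact_neq0.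
  rewrite -!natrM -(@bin_fact (2 * n.+1) n.+1); last by lia.
  by congr (_ * (_ * _`!))%:R; lia.
have eF : (2 * n.+1)`!%:R = 2 * (n%:R + 1) * (2 * n.+1).-1`!%:R :> rat.
  by rewrite natr1 -!natrM.
rewrite eC eD eF (factS n) natrM -(natr1 n) -(natr1 k).
have := fact_neq0 n; have := fact_neq0 (n - k); have := fact_neq0 (n.+1 + k).
have : (0 <= n%:R :> rat) by []; have : (0 <= k%:R :> rat) by [].
by move=> K0 N0 c0 b0 a0; field; pos_neq0.
Qed.

(** * Divisibility of binomial coefficients by a prime *)

Lemma fact_addn_prod (k a : nat) : (k + a)`! = (k`! * \prod_(u < a) (k + u.+1))%N.
Proof.
elim: a => [|a IH]; first by rewrite big_ord0 addn0 muln1.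
by rewrite big_ord_recr /= addnS factS IH mulnC mulnA.
Qed.

(** By absorption [k 'C(pN, k) = pN 'C(pN - 1, k - 1)], and [p] is prime to [k]. *)
Lemma prime_dvd_bin_mul (p N k : nat) :
  prime p -> ~~ (p %| k)%N -> (p %| 'C(p * N, k))%N.
Proof.
case: k => [|k] p_pr; first by rewrite dvdn0.
rewrite -prime_coprime // => co.
by rewrite -(Gauss_dvdr _ co) -mul_bin_diag -mulnA dvdn_mulr.
Qed.

(* The digits [a < s] force a carry. *)
Lemma prime_dvd_bin_carry (p N i a s : nat) :
  prime p -> (a < s < p)%N -> (p %| 'C(p * N + a, p * i + s))%N.
Proof.
move=> p_pr; elim: a s => [|a IH] [|s] // => /andP[lt_as lt_sp].
  rewrite addn0 prime_dvd_bin_mul // dvdn_addr ?dvdn_mulr //.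
  by rewrite gtnNdvd.
by rewrite !addnS binS dvdn_add // -?addnS IH //; lia.
Qed.

(** * Binomial coefficients and Apery numbers modulo the square of a prime *)

Section ModPrimeSquare.
(** [R] stands for [Z/p^2]: the computation rests on [p^2 = 0] and on the invertibility of integers
    prime to [p]. *)
Variables (p : nat) (R : comUnitRingType).
Hypothesis p_pr : prime p.
Hypothesis psq0 : p%:R * p%:R = 0 :> R.
Hypothesis unitR : forall k, coprime p k -> k%:R \is a @GRing.unit R.

Local Notation P := (p%:R : R).
Local Notation H := (harmonic_sum R).

Lemma unit_lt k : (0 < k < p)%N -> k%:R \is a @GRing.unit R.
Proof.
by case/andP=> k0 kp; rewrite unitR // prime_coprime // gtnNdvd.
Qed.

Lemma unit_fact k : (k < p)%N -> k`!%:R \is a @GRing.unit R.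
Proof.
elim: k => [|k IH] ltkp; first by rewrite fact0 unitr1.
by rewrite factS natrM unitrM unit_lt // IH // ltnW.
Qed.

Definition onep (x : R) : R := 1 + P * x.

Lemma onepM x y : onep x * onep y = onep (x + y).
Proof.
rewrite /onep mulrDl mul1r mulrDr mulr1 mulrACA psq0 mul0r addr0 mulrDr.
by rewrite -addrA [_ * y + _]addrC.
Qed.

Lemma onep0 : onep 0 = 1.
Proof. by rewrite /onep mulr0 addr0. Qed.

Lemma mulp_onep x : P * onep x = P.
Proof. by rewrite /onep mulrDr mulr1 mulrA psq0 mul0r addr0. Qed.

Lemma dvd_mul_eq0 a b : (p %| a)%N -> (p %| b)%N -> a%:R * b%:R = 0 :> R.
Proof.
by move=> /dvdnP[u ->] /dvdnP[v ->]; rewrite !natrM mulrACA psq0 mulr0.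
Qed.

Lemma bin_mul_mod_psq N i : 'C(p * N, p * i)%:R = 'C(N, i)%:R :> R.
Proof.
have p0 := prime_gt0 p_pr.
elim: N i => [|N IH] [|i]; rewrite ?muln0 ?bin0 ?bin0n //; first by case: p p0.
rewrite mulnS -binomial.Vandermonde natr_sum.
have lt0 : (0 < (p * i.+1).+1)%N by [].
have ltp : (p < (p * i.+1).+1)%N by rewrite ltnS leq_pmulr.
rewrite (bigD1 (Ordinal lt0)) //= (bigD1 (Ordinal ltp)) /=; last first.
  by rewrite -val_eqE /= -lt0n.
rewrite bin0 mul1n subn0 IH binn mul1n big1 ?addr0 => [|j].
  by rewrite mulnS addKn IH binS natrD.
rewrite -!val_eqE /= => /andP[j0 jp]; rewrite natrM.
have [lt_jp | le_pj] := ltnP j p; last first.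
  by rewrite bin_small ?mul0r //; lia.
apply: dvd_mul_eq0; first by apply: prime_dvd_bin => //; lia.
apply: prime_dvd_bin_mul => //.
apply: contra (_ : ~~ (p %| j)%N); last by rewrite gtnNdvd //; lia.
move=> dv; rewrite -(dvdn_addr j dv) subnK ?dvdn_mulr //; nia.
Qed.

Lemma prod_mod_psq N a : (a < p)%N ->
  \prod_(u < a) (p * N + u.+1)%:R = a`!%:R * onep (N%:R * H a).
Proof.
elim: a => [|a IH] lt_ap.
  by rewrite big_ord0 fact0 /harmonic_sum big_ord0 mulr0 onep0 mulr1.
rewrite big_ord_recr /= IH ?(ltnW lt_ap) // harmonicS.
have u : a.+1%:R \is a @GRing.unit R by rewrite unit_lt.
have -> : (p * N + a.+1)%:R = a.+1%:R * onep (N%:R / a.+1%:R).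
  rewrite /onep mulrDr mulr1 natrD natrM addrC mulrCA; congr (_ + _).
  by rewrite [_ * (_ / _)]mulrC divrK.
by rewrite factS natrM [N%:R * (_ + _)]mulrDr -onepM; ring.
Qed.

(** Lucas' congruence with its first-order term: once the factorials of [pN], [pi] and [p(N - i)]
    are split off, [prod_mod_psq] evaluates the remaining products. *)
Lemma bin_mod_psq N i a s : (s <= a < p)%N ->
  'C(p * N + a, p * i + s)%:R = 'C(N, i)%:R * 'C(a, s)%:R
     * onep (N%:R * (H a - H (a - s)) - i%:R * (H s - H (a - s))).
Proof.
case/andP=> le_sa lt_ap; have p0 := prime_gt0 p_pr.
case: (leqP i N) => [le_iN|lt_Ni]; last first.
  rewrite bin_small ?['C(N, i)]bin_small ?mul0r //.
  have : (p * N.+1 <= p * i)%N by rewrite leq_mul2l lt_Ni orbT.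
  by rewrite mulnS; lia.
have lepp : (p * i <= p * N)%N by rewrite leq_mul2l le_iN orbT.
have E : ('C(p * N + a, p * i + s) * \prod_(u < s) (p * i + u.+1)
    * \prod_(u < a - s) (p * (N - i) + u.+1)
    = 'C(p * N, p * i) * \prod_(u < a) (p * N + u.+1))%N.
  have := @bin_fact (p * N + a) (p * i + s) ltac:(lia).
  have -> : (p * N + a - (p * i + s) = p * (N - i) + (a - s))%N.
    by rewrite mulnBr; lia.
  rewrite !fact_addn_prod -(bin_fact lepp) -mulnBr => E.
  apply/eqP; rewrite -(eqn_pmul2r (fact_gt0 (p * i))).
  by rewrite -(eqn_pmul2r (fact_gt0 (p * (N - i)))); apply/eqP; lia.
move/(congr1 (fun k => k%:R : R)): E.
rewrite !natrM !natr_prod !prod_mod_psq ?bin_mul_mod_psq ?natrB //; try lia.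
move=> E.
have uU : s`!%:R * (a - s)`!%:R \is a @GRing.unit R.
  by rewrite unitrM !unit_fact //; lia.
apply: (mulrI uU).
(* The [onep] factors on the left of [E] are inverted by negating their arguments. *)
transitivity ('C(p * N + a, p * i + s)%:R * (s`!%:R * onep (i%:R * H s)) *
  ((a - s)`!%:R * onep ((N%:R - i%:R) * H (a - s)))
  * (onep (- (i%:R * H s)) * onep (- ((N%:R - i%:R) * H (a - s))))).
  rewrite [RHS](_ : _ = s`!%:R * (a - s)`!%:R * 'C(p * N + a, p * i + s)%:R
    * (onep (i%:R * H s) * onep (- (i%:R * H s)))
    * (onep ((N%:R - i%:R) * H (a - s)) * onep (- ((N%:R - i%:R) * H (a - s))))).
    by rewrite !onepM !subrr onep0 !mulr1.
  by ring.
rewrite E -(bin_fact le_sa) !natrM.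
rewrite [LHS](_ : _ = s`!%:R * (a - s)`!%:R * ('C(N, i)%:R * 'C(a, s)%:R *
   (onep (N%:R * H a) * (onep (- (i%:R * H s))
    * onep (- ((N%:R - i%:R) * H (a - s))))))); last by ring.
rewrite !onepM; congr (_ * (_ * onep _)); ring.
Qed.

(** Upper negation with a correction: each step contributes [p - (k + s + 1) = - (k + s + 1) (1 - p
    / (k + s + 1))]. *)
Lemma bin_neg_mod_psq k s : (k + s < p)%N ->
  'C(p - k.+1, s)%:R
    = (-1) ^+ s * 'C(k + s, s)%:R * onep (- (H (k + s) - H k)).
Proof.
elim: s => [|s IH] lt_ksp; first by rewrite !bin0 addn0 subrr oppr0 onep0 !mulr1.
have us : s.+1%:R \is a @GRing.unit R by rewrite unit_lt //; lia.
have uk : (k + s).+1%:R \is a @GRing.unit R by rewrite unit_lt //; lia.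
apply: (mulrI us); rewrite -natrM mul_bin_left natrM IH; last by lia.
have -> : (p - k.+1 - s)%:R = - ((k + s).+1%:R * onep (- (k + s).+1%:R^-1)).
  rewrite /onep mulrDr mulr1 mulrN mulrN mulrCA divrr // mulr1 opprB.
  by rewrite -natrB; [congr _%:R; lia | lia].
have E : s.+1%:R * 'C(k + s.+1, s.+1)%:R = (k + s).+1%:R * 'C(k + s, s)%:R :> R.
  by rewrite -!natrM addnS -mul_bin_diag.
rewrite [RHS](_ : _ = (-1) ^+ s.+1 * (s.+1%:R * 'C(k + s.+1, s.+1)%:R)
  * onep (- (H (k + s.+1) - H k))); last by ring.
rewrite E addnS harmonicS.
have -> : - (H (k + s) + (k + s).+1%:R^-1 - H k)
  = - (H (k + s) - H k) + - (k + s).+1%:R^-1 by ring.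
by rewrite -onepM exprS; ring.
Qed.

Lemma mulp_inv_sub k : (0 < k < p)%N -> P / (p - k)%:R = - (P / k%:R).
Proof.
move=> kp; have uk := unit_lt kp.
have upk : (p - k)%:R \is a @GRing.unit R by rewrite unit_lt //; lia.
apply: (mulIr upk); rewrite divrK // natrB; last by lia.
by rewrite mulNr mulrBr divrK // mulrAC psq0 mul0r sub0r opprK.
Qed.

(** Modulo [p], [1 / (p - i) = - 1 / i]: pairing [i] with [p - i] makes [H (p - 1)] vanish, and
    removing its last terms one by one gives the rest. *)
Lemma mulp_harmonic_sub k : (2 < p)%N -> (k < p)%N -> P * H (p - k.+1) = P * H k.
Proof.
move=> p2; elim: k => [|k IH] lt_kp.
  rewrite subn1 [in RHS]/harmonic_sum big_ord0 mulr0.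
  have u2 : (2%:R : R) \is a GRing.unit by rewrite unit_lt.
  apply: (mulrI u2); rewrite mulr0 [2%:R * _]mulr_natl mulr2n /harmonic_sum mulr_sumr.
  rewrite {2}(reindex_inj rev_ord_inj) -big_split big1 //= => -[i /= lt_i] _.
  have -> : (p.-1 - i.+1).+1 = (p - i.+1)%N by lia.
  by rewrite mulp_inv_sub ?subrr //; lia.
have := IH (ltnW lt_kp).
have -> : (p - k.+1 = (p - k.+2).+1)%N by lia.
rewrite !harmonicS !mulrDr => /(canRL (addrK _)) ->.
have -> : ((p - k.+2).+1 = p - k.+1)%N by lia.
by rewrite mulp_inv_sub ?opprK //; lia.
Qed.

(** * The Apery number at [m = (p - 1) / 2] and its Lucas congruence *)

Variable m : nat.
Hypothesis p_half : p = (2 * m).+1.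
Hypothesis p_ge5 : (5 <= p)%N.

(** [T s] is the leading part of the Apery summand and [1 - p X s] its correction factor. *)
Let T (s : nat) : R := (-1) ^+ s * 'C(m, s)%:R ^+ 3.
Let X (s : nat) : R := H m - H (m - s).

(** Upper negation for [m + s = p - (m - s) - 1]. *)
Lemma bin_half_mod_psq s : (s <= m)%N ->
  'C(m + s, s)%:R = (-1) ^+ s * 'C(m, s)%:R * onep (- X s).
Proof.
move=> le_sm; have := @bin_neg_mod_psq (m - s) s.
rewrite subnK // (_ : (p - (m - s).+1 = m + s)%N); last by lia.
by apply; lia.
Qed.

Lemma Apery_half_mod_psq :
  (Apery m)%:R = \sum_(s < m.+1) T s - P * \sum_(s < m.+1) T s * X s.
Proof.
rewrite /Apery big_mkord natr_sum mulr_sumr -sumrB; apply: eq_bigr => -[s /= le_s] _.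
by rewrite natrM natrX bin_half_mod_psq // /onep /T; ring.
Qed.

(** After reflection ['C(m + s, s)] enters squared, so the first-order term doubles. *)
Lemma Apery_half_mod_psq_reflected :
  (Apery m)%:R
    = (-1) ^+ m * (\sum_(s < m.+1) T s - P * (2 * \sum_(s < m.+1) T s * X s)).
Proof.
rewrite /Apery big_mkord natr_sum.
have /(congr1 (fun z : int => z%:~R : R)) := apery_reflection m.
rewrite rmorphM rmorphXn rmorphN1 !rmorph_sum /= => E.
transitivity (\sum_(i < m.+1) ('C(m, i) ^ 2 * 'C(m + i, i))%:R%:~R : R).
  by apply: eq_bigr => i _; rewrite rmorph_nat.
rewrite E; congr (_ * _); rewrite !mulr_sumr -sumrB; apply: eq_bigr => -[s /= le_s] _.
rewrite !rmorphM !rmorphXn rmorphN1 /= !rmorph_nat.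
rewrite bin_half_mod_psq // [LHS](_ : _ = ((-1) ^+ s) ^+ 2 * T s
  * (onep (- X s) * onep (- X s))); last by rewrite /T; ring.
by rewrite sqrr_sign onepM /onep; ring.
Qed.

Lemma sum_T_rev (f : nat -> R) :
  \sum_(s < m.+1) T s * f s = (-1) ^+ m * \sum_(s < m.+1) T s * f (m - s)%N.
Proof.
rewrite mulr_sumr (reindex_inj rev_ord_inj) /=; apply: eq_bigr => -[s /= lt_s] _.
have sgn : (-1) ^+ (m - s) = (-1) ^+ m * (-1) ^+ s :> R.
  by rewrite -signr_odd oddB // signr_addb !signr_odd.
by rewrite subSS /T bin_sub // sgn; ring.
Qed.

Lemma sum_T_odd : odd m -> \sum_(s < m.+1) T s = 0.
Proof.
move=> m_odd; have u2 : (2%:R : R) \is a GRing.unit by rewrite unit_lt //; lia.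
apply: (mulrI u2); rewrite mulr0 mulr_natl mulr2n.
have := sum_T_rev (fun=> 1); under eq_bigr => s _ do rewrite mulr1.
rewrite -signr_odd m_odd expr1 mulN1r => {1}->; exact: addNr.
Qed.

(** Equating the two expansions of the Apery number gives [P S = 2 P S] for [m] even; for [m] odd
    the leading sums vanish and [3 P S = 0], where [p >= 5] makes [3] invertible. *)
Lemma sum_T_X : P * \sum_(s < m.+1) T s * X s = 0.
Proof.
have := Apery_half_mod_psq_reflected; rewrite -signr_odd Apery_half_mod_psq.
case m_odd: (odd m); last first.
  rewrite expr0 mul1r => /addrI /oppr_inj E.
  move: E; set S := \sum_(s < _) _ => E.
  by transitivity (P * (2 * S) - P * S); [ring | rewrite -E subrr].
rewrite sum_T_odd // expr1 !sub0r => E.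
have u3 : (3%:R : R) \is a GRing.unit by rewrite unit_lt //; lia.
apply: (mulrI u3); rewrite mulr0.
move: E; set S := \sum_(s < _) _ => E.
transitivity (- (- (P * S)) + -1 * - (P * (2 * S))); first by ring.
by rewrite -E addNr.
Qed.

(** For [m] even, reversing [s] changes the sign of the sum. For [m] odd, [sum_T_X] and [sum_T_odd]
    kill the part with [H (m - s)], and reversal then kills the other. *)
Lemma sum_T_harmonic_sub : P * \sum_(s < m.+1) T s * (H (m - s) - H s) = 0.
Proof.
have u2 : (2%:R : R) \is a GRing.unit by rewrite unit_lt //; lia.
case m_odd: (odd m).
  have E1 : P * \sum_(s < m.+1) T s * H (m - s) = 0.
    have gen (c : R) : P * \sum_(s < m.+1) T s * H (m - s)
        = P * (c * \sum_(s < m.+1) T s)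
          - P * \sum_(s < m.+1) T s * (c - H (m - s)).
      by rewrite !mulr_sumr -sumrB; apply: eq_bigr => s _; ring.
    by rewrite (gen (H m)) sum_T_X sum_T_odd // !mulr0 subrr.
  have E2 := sum_T_rev H.
  transitivity (P * \sum_(s < m.+1) T s * H (m - s)
    - P * \sum_(s < m.+1) T s * H s).
    by rewrite !mulr_sumr -sumrB; apply: eq_bigr => s _; ring.
  by rewrite E2 mulrCA E1 mulr0 subrr.
rewrite [X in _ * X](_ : _ = 0) ?mulr0 //.
apply: (mulrI u2); rewrite mulr0 mulr_natl mulr2n.
rewrite {1}(sum_T_rev (fun s => H (m - s) - H s)) -signr_odd m_odd expr0 mul1r.
rewrite -big_split big1 //= => -[s /= lt_s] _.
by rewrite subKn //; ring.
Qed.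

Lemma Apery_half_sum : (Apery m)%:R = \sum_(s < m.+1) T s.
Proof. by rewrite Apery_half_mod_psq sum_T_X subr0. Qed.

Lemma Apery_half_odd : odd m -> (Apery m)%:R = 0 :> R.
Proof. by move=> m_odd; rewrite Apery_half_mod_psq sum_T_X sum_T_odd // subr0. Qed.

(** Write [k = pi + s]. For [s > m] a carry makes the squared binomial vanish; for [s <= m] the
    first-order terms sum to multiples of [sum_T_X] and [sum_T_harmonic_sub]. *)
Lemma Apery_lucas N :
  (Apery (p * N + m))%:R = (Apery N)%:R * (Apery m)%:R :> R.
Proof.
have natT a b : (a ^ 2 * b)%:R = a%:R ^+ 2 * b%:R :> R by rewrite natrM natrX.
pose f k : R := ('C(p * N + m, k) ^ 2 * 'C(p * N + m + k, k))%:R.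
(* The range is padded with zero terms to [N + 1] full blocks of length [p]. *)
have -> : (Apery (p * N + m))%:R = \sum_(0 <= k < N.+1 * p) f k.
  rewrite (@big_cat_nat _ _ _ (p * N + m).+1) //=; last by lia.
  rewrite [X in _ = _ + X]big_nat_cond [X in _ = _ + X]big1 ?addr0 ?natr_sum //.
  by move=> k /andP[/andP[lt_k _] _]; rewrite /f bin_small // exp0n // mul0n.
rewrite big_nat_mul /Apery natr_sum mulr_suml; apply: eq_big_nat => i lt_i.
have fE s : (s < m.+1)%N -> f (s + i * p)%N =
    ('C(N, i) ^ 2 * 'C(N + i, i))%:R * (('C(m, s) ^ 2 * 'C(m + s, s))%:R
      + N%:R * (P * (T s * X s)) + 3 * i%:R * (P * (T s * (H (m - s) - H s)))).
  move=> lt_s.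
  have -> : (s + i * p = p * i + s)%N by lia.
  rewrite /f !natT bin_mod_psq; last by lia.
  have -> : (p * N + m + (p * i + s) = p * (N + i) + (m + s))%N by lia.
  rewrite bin_mod_psq; last by lia.
  rewrite addnK natrD.
  have hE : P * H (m + s) = P * H (m - s).
    rewrite -mulp_harmonic_sub; try lia.
    by congr (_ * H _); lia.
  have TE : P * ('C(m, s)%:R ^+ 2 * 'C(m + s, s)%:R) = P * T s.
    rewrite bin_half_mod_psq // [RHS](_ : _ = P * onep (- X s) * T s).
      by rewrite /T; ring.
    by rewrite mulp_onep.
  set a1 := N%:R * _ - _; set a2 := _ * (H (m + s) - H m) - _.
  (* [a1] counts twice for the squared binomial, [a2] once for the other one. *)
  have aE : P * (a1 + a1 + a2) = P * (N%:R * X s + 3 * i%:R * (H (m - s) - H s)).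
    transitivity ((N%:R + i%:R) * (P * H (m + s)) + P * (a1 + a1
      - (N%:R + i%:R) * H m - i%:R * (H s - H m))); first by rewrite /a2; ring.
    by rewrite hE /a1 /X; ring.
  transitivity ('C(N, i)%:R ^+ 2 * 'C(N + i, i)%:R
     * ('C(m, s)%:R ^+ 2 * 'C(m + s, s)%:R * onep (a1 + a1 + a2))).
    by rewrite -!onepM; ring.
  congr (_ * _); rewrite /onep mulrDr mulr1 aE [_ * (P * _)]mulrCA mulrA TE.
  by ring.
rewrite -[(i * p)%N]add0n big_addn (_ : (i.+1 * p - i * p = p)%N); last by lia.
have le_mp : (m.+1 <= p)%N by lia.
rewrite (big_cat_nat (leq0n m.+1) le_mp) /= [X in _ + X]big_nat_cond.
rewrite [X in _ + X]big1 ?addr0 => [|s /andP[/andP[lt_ms lt_sp] _]]; last first.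
  rewrite (_ : (s + i * p = p * i + s)%N); last by lia.
  by rewrite /f natT expr2 dvd_mul_eq0 ?mul0r // prime_dvd_bin_carry // lt_ms.
rewrite (eq_big_nat _ _ (F2 := fun s => ('C(N, i) ^ 2 * 'C(N + i, i))%:R *
  (('C(m, s) ^ 2 * 'C(m + s, s))%:R + N%:R * (P * (T s * X s))
   + 3 * i%:R * (P * (T s * (H (m - s) - H s)))))) => [|s lt_s]; last exact: fE.
rewrite -mulr_sumr; congr (_ * _); rewrite !big_split /=.
by rewrite !big_mkord -!mulr_sumr sum_T_X sum_T_harmonic_sub !mulr0 !addr0 natr_sum.
Qed.

Lemma Apery_iter_half r : (Apery ((p ^ r - 1) %/ 2))%:R = (Apery m)%:R ^+ r :> R.
Proof.
elim: r => [|r IH]; first by rewrite expn0 subnn div0n /Apery big_nat1.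
(* The index is [(p^(r+1) - 1) / 2 = p (p^r - 1) / 2 + m]. *)
rewrite exprS -IH mulrC -Apery_lucas; congr (Apery _)%:R.
have : odd (p ^ r) by rewrite oddX p_half /= oddM orbT.
rewrite expnS; move: (p ^ r)%N => q q_odd.
have [k ->] : exists k, q = (2 * k).+1 by exists q./2; lia.
rewrite mulnS mulnCA !subn1 /= mulKn //.
by rewrite (_ : (p + 2 * (p * k)).-1 = (p * k + m) * 2)%N ?mulnK //; lia.
Qed.

End ModPrimeSquare.

(* [y] is the image of the rational number [q] in the ring [R], in which the
   denominator of [q] is invertible. *)
Definition represents (R : comUnitRingType) (q : rat) (y : R) :=
  exists (a : int) (d : nat),
    [/\ d%:R \is a @GRing.unit R, q = a%:~R / d%:R & y = a%:~R / d%:R].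

(** * Transfer of identities from the rationals to [R] *)

Section Represents.
Variable R : comUnitRingType.
Implicit Types (q : rat) (y : R).

Lemma natr_unit_neq0 (d : nat) : d%:R \is a @GRing.unit R -> d%:R != 0 :> rat.
Proof. by rewrite pnatr_eq0; apply: contraL => /eqP->; rewrite unitr0. Qed.

(** Cross-multiplication takes place in the integers, so an equality of rationals with denominators
    invertible in [R] passes to [R]. *)
Lemma represents_inj q y y' : represents q y -> represents q y' -> y = y'.
Proof.
move=> [a [d [ud -> ->]]] [a' [d' [ud' E ->]]].
have d0 := natr_unit_neq0 ud; have d0' := natr_unit_neq0 ud'.
have {}E : a * d' = a' * d.
  have /eqP := E; rewrite eqr_div // => /eqP E'.
  apply: (@intr_inj rat); rewrite !rmorphM /=; exact: E'.
apply: (mulIr ud); apply: (mulIr ud'); rewrite divrK // mulrAC divrK //.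
by have := congr1 (fun z : int => z%:~R : R) E; rewrite !rmorphM /=.
Qed.

Lemma represents_int (a : int) : represents a%:~R (a%:~R : R).
Proof. by exists a, 1%N; rewrite unitr1 !divr1. Qed.

Lemma represents_nat (a : nat) : represents a%:R (a%:R : R).
Proof. exact: (represents_int a). Qed.

Lemma represents_sign k : represents ((-1) ^+ k) ((-1) ^+ k : R).
Proof. by have := represents_int ((-1) ^+ k); rewrite !rmorphXn !rmorphN1. Qed.

Lemma represents_inv (d : nat) :
  d%:R \is a @GRing.unit R -> represents d%:R^-1 (d%:R^-1 : R).
Proof. by move=> ud; exists 1, d; rewrite !mul1r. Qed.

Lemma represents_add q y q' y' :
  represents q y -> represents q' y' -> represents (q + q') (y + y').
Proof.
move=> [a [d [ud -> ->]]] [a' [d' [ud' -> ->]]].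
have d0 := natr_unit_neq0 ud; have d0' := natr_unit_neq0 ud'.
exists (a * d' + a' * d), (d * d')%N; split.
- by rewrite natrM unitrM ud ud'.
- by rewrite addf_div // natrM rmorphD !rmorphM.
have udd : (d * d')%:R \is a @GRing.unit R by rewrite natrM unitrM ud ud'.
apply: (mulIr udd); rewrite divrK // natrM rmorphD !rmorphM /=.
transitivity (a%:~R * (d%:R^-1 * d%:R) * d'%:R
  + a'%:~R * (d'%:R^-1 * d'%:R) * d%:R : R); first by ring.
by rewrite !mulVr // !mulr1.
Qed.

Lemma represents_mul q y q' y' :
  represents q y -> represents q' y' -> represents (q * q') (y * y').
Proof.
move=> [a [d [ud -> ->]]] [a' [d' [ud' -> ->]]].
exists (a * a'), (d * d')%N; split; first by rewrite natrM unitrM ud ud'.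
- by rewrite natrM invfM rmorphM /= mulrACA.
- by rewrite natrM invrM // rmorphM /= [_^-1 * _]mulrC mulrACA.
Qed.

Lemma represents_opp q y : represents q y -> represents (- q) (- y).
Proof.
by move=> h; have := represents_mul (represents_int (-1)) h; rewrite !mulN1r.
Qed.

Lemma represents_sum n (f : nat -> rat) (g : nat -> R) :
  (forall i, (i < n)%N -> represents (f i) (g i)) ->
  represents (\sum_(i < n) f i) (\sum_(i < n) g i).
Proof.
elim: n => [|n IH] fg; first by rewrite !big_ord0; exact: represents_nat 0.
rewrite !big_ord_recr /=; apply: represents_add; last exact: fg.
by apply: IH => i lt_i; apply: fg; rewrite ltnW.
Qed.

Lemma represents_harmonic n :
  (forall i, (0 < i <= n)%N -> i%:R \is a @GRing.unit R) ->
  represents (harmonic_sum rat n) (harmonic_sum R n).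
Proof.
move=> un; apply: (@represents_sum n (fun i => i.+1%:R^-1) (fun i => i.+1%:R^-1)).
by move=> i lt_i; apply: represents_inv; apply: un.
Qed.

End Represents.

(** * Jacobi sums through the Teichmuller character *)

Section Teichmuller.
Variables (p : nat) (R : comUnitRingType).
Hypothesis p_pr : prime p.
Hypothesis psq0 : p%:R * p%:R = 0 :> R.
Hypothesis unitR : forall k, coprime p k -> k%:R \is a @GRing.unit R.

Local Notation P := (p%:R : R).
Local Notation H := (harmonic_sum R).
Local Notation onep := (@onep p R).

Lemma exprDp (v w : R) k : (v + P * w) ^+ k = v ^+ k + P * w * (k%:R * v ^+ k.-1).
Proof.
elim: k => [|k IH]; first by rewrite !expr0 mul0r mulr0 addr0.
rewrite exprS IH /=; case: k {IH} => [|k].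
  by rewrite !expr0 expr1 /=; ring.
rewrite [LHS](_ : _ = v ^+ k.+2 + P * w * (k.+2%:R * v ^+ k.+1)
   + P * P * (w * w * (k.+1%:R * v ^+ k))) ; last first.
  by rewrite /= !exprS -!natr1; ring.
by rewrite psq0 mul0r addr0.
Qed.

Lemma exprDpp (v w : R) : (v + P * w) ^+ p = v ^+ p.
Proof.
rewrite exprDp [P * w * _](_ : _ = P * P * (w * v ^+ p.-1)); last by ring.
by rewrite psq0 mul0r addr0.
Qed.

(** Modulo [p^2] the [p]-th power of a lift depends only on its class modulo [p]: it is the
    Teichmuller representative. *)
Definition teich (x : 'F_p) : R := (x : nat)%:R ^+ p.

Lemma natr_val_Fp (x : 'F_p) : (x : nat)%:R = x.
Proof. by rewrite natr_Zp. Qed.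

Lemma teich_nat k : k%:R ^+ p = teich k%:R.
Proof.
by rewrite /teich val_Fp_nat // {1}(divn_eq k p) natrD natrM addrC mulrC exprDpp.
Qed.

Lemma teichM : {morph teich : x y / x * y}.
Proof.
move=> x y; rewrite {2 3}/teich -exprMn -natrM teich_nat natrM.
by rewrite !natr_val_Fp.
Qed.

Lemma teich1 : teich 1 = 1.
Proof. by rewrite -[1 in LHS]/(1%:R) -teich_nat expr1n. Qed.

Lemma teich0 : teich 0 = 0.
Proof. by rewrite -[0 in LHS]/(0%:R) -teich_nat expr0n gtn_eqF // prime_gt0. Qed.

Lemma teichX x k : teich (x ^+ k) = teich x ^+ k.
Proof. by elim: k => [|k IH]; rewrite ?expr0 ?teich1 // !exprS teichM IH. Qed.

Lemma Fp_expp (x : 'F_p) : x ^+ p = x.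
Proof. by have := expf_card x; rewrite card_Fp. Qed.

Lemma teich_p x : teich x ^+ p = teich x.
Proof. by rewrite -teichX Fp_expp. Qed.

Lemma eq_mod_p (a b : nat) : (a%:R = b%:R :> 'F_p) -> exists c, a%:R = b%:R + P * c.
Proof.
move/(congr1 (@nat_of_ord _)); rewrite !val_Fp_nat // => E.
exists ((a %/ p)%:R - (b %/ p)%:R).
rewrite {1}(divn_eq a p) {1}(divn_eq b p) E !natrD !natrM; ring.
Qed.

(** [1 - teich x] and the lift of [1 - x] agree modulo [p], hence have the same [p]-th power. *)
Lemma teich_sub x : teich (1 - x) = (1 - teich x) ^+ p.
Proof.
have [c E] : exists c, ((1 - x)%R : nat)%:R + (x : nat)%:R = 1 + P * c.
  have [c] := @eq_mod_p ((1 - x)%R + x)%N 1 ltac:(by rewrite natrD !natr_val_Fp subrK).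
  by rewrite natrD => E; exists c.
have [c' E'] : exists c, teich x = (x : nat)%:R + P * c.
  by rewrite /teich -natrX; apply: eq_mod_p; rewrite natrX natr_val_Fp Fp_expp.
rewrite {1}/teich -[in RHS](exprDpp _ (c + c')); congr (_ ^+ p).
rewrite E' mulrDr [RHS](_ : _ = 1 + P * c - (x : nat)%:R); last by ring.
by rewrite -E addrK.
Qed.

Lemma natr_Fp_eq0 (k : nat) : (k%:R == 0 :> 'F_p) = (p %| k)%N.
Proof. by rewrite (dvdn_pcharf (pchar_Fp p_pr)). Qed.

Lemma unit_teich_sub1 (y : 'F_p) : y != 1 -> teich y - 1 \is a GRing.unit.
Proof.
move=> y1; have [-> | y0] := eqVneq y 0; first by rewrite teich0 sub0r unitrN1.
have y_gt0 : (0 < (y : nat) ^ p)%N.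
  rewrite expn_gt0 lt0n; apply/orP; left.
  by apply: contra y0 => /eqP y0; apply/eqP/val_inj.
rewrite /teich -natrX -[1]/(1%:R) -natrB // unitR // prime_coprime //.
by rewrite -natr_Fp_eq0 natrB // natrX natr_val_Fp Fp_expp subr_eq0.
Qed.

(** * Power sums of Teichmuller representatives *)

Definition teich_psum k : R := \sum_(x : 'F_p) teich x ^+ k.

Lemma Fp_expp1 (x : 'F_p) : x != 0 -> x ^+ p.-1 = 1.
Proof.
move=> x0; apply: (mulfI x0); rewrite -exprS prednK ?prime_gt0 // Fp_expp mulr1 //.
Qed.

(** Otherwise, with [k'] the residue of [k] modulo [p - 1], [X^k' - 1] would have more roots than
    its degree. *)
Lemma Fp_expr_neq1 k : ~~ (p.-1 %| k)%N -> exists2 g : 'F_p, g != 0 & g ^+ k != 1.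
Proof.
move=> ndv; apply/exists_inP; apply: contraNT ndv.
rewrite negb_exists_in => /forall_inP all1.
have p1 : (0 < p.-1)%N by have := prime_gt1 p_pr; lia.
apply/eqP; apply/eqP; rewrite -[_ == _]negbK; apply/negP; rewrite -lt0n => k0.
set k' := (k %% p.-1)%N in k0.
have := @max_poly_roots 'F_p ('X^k' - 1%:P) (enum [pred x : 'F_p | x != 0]).
rewrite -size_poly_eq0 size_XnsubC // => /(_ isT).
have -> : size (enum [pred x : 'F_p | x != 0]) = p.-1.
  by rewrite -cardE cardC1 card_Fp.
rewrite enum_uniq ltnS => H; suff : (p.-1 <= k')%N by rewrite leqNgt ltn_mod p1.
apply: H => //; apply/allP => x; rewrite mem_enum inE => x0.
rewrite rootE !hornerE subr_eq0 -(negbK (_ == 1)) /k'.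
have := all1 _ x0; rewrite negbK {1}(divn_eq k p.-1) exprD mulnC exprM.
by rewrite Fp_expp1 // expr1n mul1r => ->.
Qed.

(** Reindexing by [x -> g x] multiplies the sum by [teich (g ^+ k)], and [teich (g ^+ k) - 1] is
    invertible. *)
Lemma teich_psum_eq0 k : ~~ (p.-1 %| k)%N -> teich_psum k = 0.
Proof.
move=> /Fp_expr_neq1[g g0 gk]; have u := unit_teich_sub1 gk.
apply: (mulrI u); rewrite mulr0 mulrBl mul1r; apply/eqP; rewrite subr_eq0; apply/eqP.
rewrite [RHS](reindex_inj (mulfI g0)) mulr_sumr; apply: eq_bigr => x _.
by rewrite teichM exprMn teichX.
Qed.

Lemma teich_psum_dvd k : (0 < k)%N -> (p.-1 %| k)%N -> teich_psum k = P - 1.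
Proof.
move=> k0 /dvdnP[c kE]; rewrite /teich_psum (bigD1 0) //= teich0 expr0n gtn_eqF // add0r.
rewrite (eq_bigr (fun=> 1)) => [|x x0]; last first.
  by rewrite -teichX kE mulnC exprM Fp_expp1 // expr1n teich1.
by rewrite sumr_const cardC1 card_Fp // -subn1 natrB // prime_gt0.
Qed.

Lemma mulp_teich_psum k : (0 < k)%N ->
  P * teich_psum k = - (P *+ (p.-1 %| k)%N).
Proof.
move=> k0; have [dv | ndv] := boolP (p.-1 %| k)%N.
  by rewrite teich_psum_dvd // mulrBr psq0 mulr1 sub0r.
by rewrite teich_psum_eq0 // mulr0 mulr0n oppr0.
Qed.

Lemma expr_one_sub k (t : R) :
  (1 - t) ^+ k = \sum_(l < k.+1) (-1) ^+ l * 'C(k, l)%:R * t ^+ l.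
Proof.
rewrite exprBn; apply: eq_bigr => i _.
by rewrite expr1n mulr1 -mulr_natr; ring.
Qed.

(** Here ['C(p, k + 1) = (-1)^k p / (k + 1)], and the top term simplifies by
    [teich x ^+ p = teich x]. *)
Lemma one_sub_teich_p x : odd p ->
  (1 - teich x) ^+ p
    = 1 - teich x + P * (- \sum_(k < p.-1) teich x ^+ k.+1 / k.+1%:R).
Proof.
move=> p_odd; have p0 := prime_gt0 p_pr; have p1 := prime_gt1 p_pr.
have binE k : (k < p.-1)%N -> 'C(p, k.+1)%:R = (-1) ^+ k * (P / k.+1%:R).
  move=> lt_k; have uk : k.+1%:R \is a @GRing.unit R.
    by apply: (unit_lt p_pr unitR); lia.
  apply: (mulrI uk); rewrite -natrM -mul_bin_diag natrM -subn1.
  rewrite (bin_neg_mod_psq p_pr psq0 unitR); last by lia.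
  rewrite binn mulr1 mulrCA (mulp_onep psq0) mulrCA; congr (_ * _).
  by rewrite mulrCA divrr ?mulr1.
rewrite expr_one_sub.
rewrite -(big_mkord predT (fun l => (-1) ^+ l * 'C(p, l)%:R * teich x ^+ l)).
rewrite big_nat_recl // [X in index_iota 0 X](_ : p = p.-1.+1); last by rewrite prednK.
rewrite big_nat_recr //= prednK // bin0 !expr0 !mulr1 binn mulr1 teich_p.
rewrite -signr_odd p_odd expr1 mulN1r [_ - teich x]addrC addrA; congr (_ + _).
rewrite big_mkord mulrN mulr_sumr -sumrN; apply: eq_bigr => -[k /= lt_k] _.
transitivity (- (((-1) ^+ k) ^+ 2 * (P * (teich x ^+ k.+1 / k.+1%:R)))).
  by rewrite binE // !exprS; ring.
by rewrite sqrr_sign mul1r.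
Qed.

(** As [p^2 = 0], the power of [1 - t + p L] is [(1 - t)^(B+1) + (B + 1) p L (1 - t)^B]; expanding
    and summing over [x] leaves power sums. *)
Lemma jacobi_sumE A B : odd p ->
  \sum_(x : 'F_p) teich x ^+ A * teich (1 - x) ^+ B.+1
  = \sum_(l < B.+2) (-1) ^+ l * 'C(B.+1, l)%:R * teich_psum (A + l)
    - B.+1%:R * \sum_(l < B.+1) (-1) ^+ l * 'C(B, l)%:R *
        (\sum_(k < p.-1) P * teich_psum (A + l + k.+1) / k.+1%:R).
Proof.
move=> p_odd.
have termE x : teich x ^+ A * teich (1 - x) ^+ B.+1
   = \sum_(l < B.+2) (-1) ^+ l * 'C(B.+1, l)%:R * teich x ^+ (A + l)
    - B.+1%:R * \sum_(l < B.+1) (-1) ^+ l * 'C(B, l)%:R *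
        (\sum_(k < p.-1) P * teich x ^+ (A + l + k.+1) / k.+1%:R).
  rewrite teich_sub one_sub_teich_p // exprDp /= !expr_one_sub mulrDr mulr_sumr.
  congr (_ + _).
    by apply: eq_bigr => l _; rewrite exprD; ring.
  set S := \sum_(k < _) _; rewrite -mulrN mulrN.
  transitivity (- (B.+1%:R * (\sum_(l < B.+1)
      (-1) ^+ l * 'C(B, l)%:R * (P * teich x ^+ (A + l) * S)))).
    rewrite -[X in _ = - (_ * X)](_ : teich x ^+ A * P * S *
      (\sum_(l < B.+1) (-1) ^+ l * 'C(B, l)%:R * teich x ^+ l) = _).
      by ring.
    by rewrite mulr_sumr; apply: eq_bigr => l _; rewrite exprD; ring.
  congr (- (_ * _)); apply: eq_bigr => l _; congr (_ * _).
  rewrite /S mulr_sumr; apply: eq_bigr => k _.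
  by rewrite (exprD _ (A + l)); ring.
under eq_bigr => x _ do rewrite termE.
rewrite sumrB; congr (_ - _).
  by rewrite exchange_big; apply: eq_bigr => l _; rewrite mulr_sumr.
rewrite -mulr_sumr; congr (_ * _); rewrite exchange_big; apply: eq_bigr => l _.
rewrite -mulr_sumr; congr (_ * _); rewrite exchange_big; apply: eq_bigr => k _.
by rewrite /teich_psum mulr_sumr mulr_suml.
Qed.

(** Among [p - 1] consecutive exponents only one is a multiple of [p - 1], and there [p] times the
    power sum is [- p]. *)
Lemma sum_psum_inv e k : (k < p.-1)%N -> (p.-1 %| e + k.+1)%N ->
  \sum_(i < p.-1) P * teich_psum (e + i.+1) / i.+1%:R = - (P / k.+1%:R).
Proof.
move=> lt_k dv; rewrite (bigD1 (Ordinal lt_k)) //= mulp_teich_psum ?addnS // -addnS dv.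
rewrite big1 ?addr0 ?mulr1n ?mulNr // => -[i /= lt_i]; rewrite -val_eqE /= => neq.
rewrite mulp_teich_psum ?addnS // -addnS.
suff /negPf-> : ~~ (p.-1 %| e + i.+1)%N by rewrite mulr0n oppr0 mul0r.
apply/negP => /dvdnP[c cE]; case/dvdnP: dv => d dE.
have : (c = d)%N by nia.
lia.
Qed.

(** * Evaluation of two Jacobi sums for [p = 4n + 1] *)

Variable n : nat.
Hypothesis p_quarter : p = (4 * n).+1.

Let n_gt0 : (0 < n)%N.
Proof. by have := prime_gt1 p_pr; lia. Qed.

Let p1E : p.-1 = (4 * n)%N. Proof. by rewrite p_quarter. Qed.

Let p_odd : odd p. Proof. by rewrite p_quarter /= oddM. Qed.

Let unit_small k : (0 < k < p)%N -> k%:R \is a @GRing.unit R.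
Proof. exact: (unit_lt p_pr unitR). Qed.

Let p4n : P * (4 * n)%:R = - P.
Proof.
have -> : (4 * n)%:R = P - 1 :> R by rewrite p_quarter -natr1 addrK.
by rewrite mulrBr psq0 sub0r mulr1.
Qed.

(** The exponent [2n] gives the quadratic character; [A = n] and [A = 3n] give the two quartic
    ones. *)
Definition jacobi_sum A : R := \sum_(x : 'F_p) teich x ^+ A * teich (1 - x) ^+ (2 * n).

Lemma sum_inv_bin_ring :
  \sum_(l < 2 * n) (-1) ^+ l * 'C((2 * n).-1, l)%:R / (n + l).+1%:R
    = ((2 * n).-1`! * n`!)%:R / (3 * n)`!%:R :> R.
Proof.
apply: (@represents_inj R (((2 * n).-1`! * n`!)%:R / (3 * n)`!%:R)); last first.
  apply: represents_mul; first exact: represents_nat.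
  by apply: represents_inv; apply: (unit_fact p_pr unitR); lia.
have := sum_inv_bin (2 * n).-1 n; rewrite prednK ?muln_gt0 //.
have -> : (n + (2 * n).-1).+1 = (3 * n)%N by lia.
move=> <-.
apply: (@represents_sum R (2 * n)
  (fun l => (-1) ^+ l * 'C((2 * n).-1, l)%:R / (n + l).+1%:R)
  (fun l => (-1) ^+ l * 'C((2 * n).-1, l)%:R / (n + l).+1%:R)) => l lt_l.
apply: represents_mul; last by apply: represents_inv; apply: unit_small; lia.
apply: represents_mul; last exact: represents_nat.
exact: represents_sign.
Qed.

(** No exponent from [n] to [3n] is a multiple of [4n], so the leading part vanishes; the
    first-order part is a beta sum. *)
Lemma jacobi_sum_n :
  jacobi_sum n = - (P * ((2 * n)`! * n`!)%:R / (3 * n)`!%:R).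
Proof.
have E2n : (2 * n = (2 * n).-1.+1)%N by lia.
rewrite /jacobi_sum [in LHS]E2n jacobi_sumE // big1 ?sub0r => [|l _]; last first.
  rewrite teich_psum_eq0 ?mulr0 // gtnNdvd ?p_quarter //=; first by lia.
  by case: l => /= l; lia.
congr (- _); rewrite -E2n.
transitivity ((2 * n)%:R * (P * (\sum_(l < 2 * n)
    (-1) ^+ l * 'C((2 * n).-1, l)%:R / (n + l).+1%:R))).
  (* After reversal, the exponent reaches [4n] exactly at [k = n + l]. *)
  congr (_ * _); rewrite (reindex_inj rev_ord_inj) mulr_sumr /=; apply: eq_bigr.
  move=> -[l /= lt_l] _.
  have -> : (2 * n - l.+1 = (2 * n).-1 - l)%N by lia.
  rewrite (@sum_psum_inv _ (n + l)); [|lia|rewrite p1E]; last first.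
    by have -> : (n + ((2 * n).-1 - l) + (n + l).+1 = 4 * n)%N by lia.
  rewrite bin_sub; last by lia.
  have -> : (-1) ^+ ((2 * n).-1 - l) = - (-1) ^+ l :> R.
    rewrite -signr_odd oddB; last by lia.
    by rewrite (_ : odd (2 * n).-1 = true) ?signr_addb ?signr_odd ?mulN1r //; lia.
  by ring.
rewrite sum_inv_bin_ring {1}E2n !natrM E2n factS -E2n natrM; ring.
Qed.

(** In the leading part only [l = n], of exponent [4n], contributes; [alt_sum_central_bin] evaluates
    the first-order part. *)
Lemma jacobi_sum_3n :
  jacobi_sum (3 * n)
    = - ((-1) ^+ n * 'C(2 * n, n)%:R * onep ((2 * n)%:R * (H (2 * n) - H n))).
Proof.
have E2n : (2 * n = (2 * n).-1.+1)%N by lia.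
rewrite /jacobi_sum [in LHS]E2n jacobi_sumE //.
rewrite -E2n.
have lt_n : (n < (2 * n).+1)%N by lia.
rewrite (bigD1 (Ordinal lt_n)) //= big1 ?addr0 => [|l]; last first.
  rewrite -val_eqE /= => neq; rewrite teich_psum_eq0 ?mulr0 //.
  rewrite p_quarter /=; apply/negP => /dvdnP[c cE].
  have lt_l : (l < (2 * n).+1)%N by [].
  by case: c cE => [|[|c]]; rewrite ?mulSn; lia.
rewrite teich_psum_dvd; [|lia|rewrite p_quarter /=]; last first.
  by have -> : (3 * n + n = 4 * n)%N by lia.
pose V : R := \sum_(k < n) (-1) ^+ k * 'C((2 * n).-1, n - k.+1)%:R / k.+1%:R.
have VE : 2 * V = 'C(2 * n, n)%:R * (H (2 * n) - H n + (2 * n)%:R^-1).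
  apply: (@represents_inj R _ _ _ _ (_ : represents ('C(2 * n, n)%:R
    * (harmonic_sum rat (2 * n) - harmonic_sum rat n + (2 * n)%:R^-1)) _)); last first.
    apply: represents_mul; first exact: represents_nat.
    apply: represents_add; last by apply: represents_inv; apply: unit_small; lia.
    apply: represents_add.
      by apply: represents_harmonic => i ?; apply: unit_small; lia.
    apply: represents_opp.
    by apply: represents_harmonic => i ?; apply: unit_small; lia.
  rewrite -alt_sum_central_bin //; apply: represents_mul.
    exact: (represents_nat R 2).
  apply: (@represents_sum R n
    (fun k => (-1) ^+ k * 'C((2 * n).-1, n - k.+1)%:R / k.+1%:R)
    (fun k => (-1) ^+ k * 'C((2 * n).-1, n - k.+1)%:R / k.+1%:R)) => k lt_k.
  apply: represents_mul; last by apply: represents_inv; apply: unit_small; lia.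
  by apply: represents_mul; [exact: represents_sign | exact: represents_nat].
transitivity ((-1) ^+ n * 'C(2 * n, n)%:R * (P - 1)
  - (2 * n)%:R * ((-1) ^+ n * (P * (2 * V)))).
  congr (_ - _ * _).
  (* For [l = n - 1 - t] the exponent reaches [4n] at [k = t]; for [l = n + t] it reaches [8n] at
     [k = 4n - 1 - t]. The two contributions agree, whence [2 V]. *)
  rewrite -(big_mkord predT (fun l => (-1) ^+ l * 'C((2 * n).-1, l)%:R *
    (\sum_(k < p.-1) P * teich_psum (3 * n + l + k.+1) / k.+1%:R))).
  have len : (n <= 2 * n)%N by lia.
  rewrite (big_cat_nat (leq0n n) len) /= -[X in _ + \sum_(X <= _ < _) _]add0n.
  rewrite [X in _ + X]big_addn (_ : 2 * n - n = n)%N; last by lia.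
  rewrite !big_mkord (reindex_inj rev_ord_inj) -big_split /V !mulr_sumr.
  apply: eq_bigr => -[t /= lt_t] _.
  rewrite (@sum_psum_inv _ t); [|lia|rewrite p1E]; last first.
    by have -> : (3 * n + (n - t.+1) + t.+1 = 4 * n)%N by lia.
  rewrite (@sum_psum_inv _ (4 * n - t.+1)); [|lia|rewrite p1E]; last first.
    have -> : (3 * n + (t + n) + (4 * n - t.+1).+1 = 2 * (4 * n))%N by lia.
    exact: dvdn_mull.
  have -> : ((4 * n - t.+1).+1 = p - t.+1)%N by lia.
  rewrite (mulp_inv_sub p_pr psq0 unitR); last by lia.
  have -> : 'C((2 * n).-1, t + n) = 'C((2 * n).-1, n - t.+1).
    rewrite -[RHS]bin_sub; last by lia.
    by congr 'C(_, _); lia.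
  have -> : (-1) ^+ (n - t.+1) = - (-1) ^+ n * (-1) ^+ t :> R.
    rewrite -signr_odd oddB // signr_addb !signr_odd exprS; ring.
  by rewrite exprD; ring.
rewrite VE /onep.
have u2n : (2 * n)%:R \is a @GRing.unit R by apply: unit_small; lia.
(* The last term comes from [(2 * n)%:R^-1] in [VE] and cancels the [P] of [P - 1]. *)
transitivity ((-1) ^+ n * 'C(2 * n, n)%:R * (P - 1
  - P * ((2 * n)%:R * (H (2 * n) - H n)) - P * ((2 * n)%:R / (2 * n)%:R))).
  by ring.
by rewrite divrr //; ring.
Qed.

Let binE : 'C(3 * n, n)%:R
  = (-1) ^+ n * 'C(2 * n, n)%:R * onep (- (H (2 * n) - H n)) :> R.
Proof.
have := @bin_neg_mod_psq p R p_pr psq0 unitR n n.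
rewrite (_ : (p - n.+1 = 3 * n)%N); last by lia.
rewrite (_ : (n + n = 2 * n)%N); last by lia.
by apply; lia.
Qed.

Lemma jacobi_sum_mul : jacobi_sum n * jacobi_sum (3 * n) = P.
Proof.
have u3n : (3 * n)`!%:R \is a @GRing.unit R.
  by apply: (unit_fact p_pr unitR); lia.
apply: (mulIr u3n); rewrite jacobi_sum_n jacobi_sum_3n mulrNN.
set a := onep _; set F := ((2 * n)`! * n`!)%:R.
transitivity (P * a * ((-1) ^+ n * 'C(2 * n, n)%:R) * F
  * ((3 * n)`!%:R^-1 * (3 * n)`!%:R)); first by ring.
(* Behind the factor [P] one [onep] may replace another; this one turns ['C(2 * n, n)] into
   ['C(3 * n, n)] by [binE]. *)
rewrite mulVr // mulr1 (mulp_onep psq0) -{1}(mulp_onep psq0 (- (H (2 * n) - H n))).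
rewrite -/onep [P * _ * _](_ : _ = P * 'C(3 * n, n)%:R); last first.
  by rewrite binE; ring.
rewrite -mulrA -natrM; congr (_ * _%:R).
rewrite -(@bin_fact (3 * n) n); last by lia.
by rewrite (_ : (3 * n - n = 2 * n)%N) 1?[(n`! * _)%N]mulnC //; lia.
Qed.

Lemma jacobi_sum_n_sqr : jacobi_sum n ^+ 2 = 0.
Proof.
rewrite jacobi_sum_n sqrrN -mulrA exprMn expr2 psq0 mul0r //.
Qed.

(** As [4n p = - p], the square is ['C(2n, n)^2 onep (H n - H (2n))], which by [binE] is
    [(-1)^n 'C(3n, n) 'C(2n, n)], Dixon's value of the Apery sum. *)
Lemma jacobi_sum_3n_sqr : (5 <= p)%N -> jacobi_sum (3 * n) ^+ 2 = (Apery (2 * n))%:R.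
Proof.
move=> p5; rewrite (Apery_half_sum p_pr psq0 unitR) //; try lia.
transitivity ('C(2 * n, n)%:R ^+ 2 * onep (- (H (2 * n) - H n))).
  rewrite jacobi_sum_3n sqrrN !exprMn sqrr_sign mul1r [onep _ ^+ 2]expr2 onepM //.
  congr (_ * (1 + _)); rewrite -mulrDl mulrA -natrD.
  rewrite (_ : 2 * n + 2 * n = 4 * n)%N; last by lia.
  by rewrite p4n mulrN mulNr.
have /(congr1 (fun z : int => z%:~R : R)) := dixon n n.
rewrite rmorph_sum rmorphM rmorphXn rmorphN1 /= rmorph_nat natrM => E.
transitivity ((-1) ^+ n * ('C(2 * n + n, n)%:R * 'C(2 * n, n)%:R) : R).
  rewrite (_ : 2 * n + n = 3 * n)%N ?binE; last by lia.
  transitivity (((-1) ^+ n) ^+ 2 * ('C(2 * n, n)%:R ^+ 2 * onep (- (H (2 * n) - H n)))).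
    by rewrite sqrr_sign mul1r.
  by ring.
rewrite -E; apply: eq_bigr => -[s /= lt_s] _.
rewrite !rmorphM rmorphXn rmorphN1 /= !rmorph_nat (_ : n + n = 2 * n)%N; last by lia.
by rewrite bin_sub //; ring.
Qed.

(** * The Jacobi sums as conjugate Gaussian integers of norm [p] *)

Hypothesis injR : forall z : int, z%:~R = 0 :> R -> ((p ^ 2)%N %| z)%Z.

Section SumOfTwoSquares.
Variable i0 : 'F_p.
Hypothesis i0_sqr : i0 ^+ 2 = -1.

(* A fourth root of unity [z] in ['F_p] is the reduction of the complex number
   [re z + i im z], where [i] reduces to [i0]. *)
Let re (z : 'F_p) : int := (z == 1)%:R - (z == -1)%:R.
Let im (z : 'F_p) : int := (z == i0)%:R - (z == - i0)%:R.

Let N1_neq1 : (-1 == 1 :> 'F_p) = false.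
Proof.
by rewrite eq_sym -subr_eq0 opprK -[1 + 1]/(2%:R) natr_Fp_eq0 gtnNdvd //; lia.
Qed.

Let i0_neq : [/\ (i0 == 1) = false, (i0 == -1) = false, (i0 == - i0) = false
  & (i0 == 0) = false].
Proof.
have H1 : i0 ^+ 2 != 1 by rewrite i0_sqr N1_neq1.
have H0 : (i0 == 0) = false.
  apply/negP => /eqP E; move/eqP: i0_sqr.
  by rewrite E expr0n /= eq_sym oppr_eq0 oner_eq0.
split=> //; first by apply: contraNF H1 => /eqP->; rewrite expr1n.
  by apply: contraNF H1 => /eqP->; rewrite sqrrN expr1n.
rewrite -subr_eq0 opprK -mulr2n -mulr_natr mulf_eq0 H0 natr_Fp_eq0 gtnNdvd //.
by lia.
Qed.

Let quartic (z : 'F_p) : z = 0 \/ z ^+ 4 = 1 ->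
  [\/ z = 0, z = 1, z = -1 | z = i0 \/ z = - i0].
Proof.
case=> [->|z4]; first by constructor 1.
have : (z ^+ 2 - 1) * (z ^+ 2 - i0 ^+ 2) == 0.
  by rewrite i0_sqr -(subrr (1 : 'F_p)) -{3}z4; apply/eqP; ring.
rewrite mulf_eq0 !subr_eq0 -[X in _ == X](expr1n 'F_p 2) !eqf_sqr.
case/orP=> /orP[] /eqP->; first by constructor 2.
- by constructor 3.
- by constructor 4; left.
- by constructor 4; right.
Qed.

Let valE :
  [/\ re 0 = 0, re 1 = 1, re (-1) = -1, re i0 = 0 & re (- i0) = 0]
  /\ [/\ im 0 = 0, im 1 = 0, im (-1) = 0, im i0 = 1 & im (- i0) = -1].
Proof.
have [h1 h2 h3 h4] := i0_neq.
have e1 : (-i0 == 1) = false by rewrite eqr_oppLR.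
have e2 : (-i0 == -1) = false by rewrite eqr_opp.
have e3 : (0 == -1 :> 'F_p) = false by rewrite eq_sym oppr_eq0 oner_eq0.
have e4 : (0 == - i0) = false by rewrite eq_sym oppr_eq0.
rewrite /re /im !eqxx N1_neq1 h1 h2 h3 e1 e2 e3 e4 [0 == 1]eq_sym oner_eq0.
rewrite [1 == -1]eq_sym N1_neq1 [0 == i0]eq_sym h4 [1 == i0]eq_sym h1.
rewrite [1 == - i0]eq_sym e1 [-1 == i0]eq_sym h2 [-1 == - i0]eq_sym e2.
by rewrite [- i0 == i0]eq_sym h3.
Qed.

Let I : R := teich i0.

Let teichN1 : teich (-1) = -1.
Proof.
have p0 := prime_gt0 p_pr.
have -> : -1 = p.-1%:R :> 'F_p.
  by apply/eqP; rewrite eq_sym -addr_eq0 natr1 prednK // natr_Fp_eq0.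
rewrite -teich_nat -subn1 natrB // addrC -[P]mulr1 exprDpp.
by rewrite -signr_odd p_odd.
Qed.

Let I_sqr : I ^+ 2 = -1.
Proof. by rewrite /I -teichX i0_sqr teichN1. Qed.

Let teichN z : teich (- z) = - teich z.
Proof. by rewrite -mulN1r teichM teichN1 mulN1r. Qed.

(** Cubing conjugates a fourth root of unity, so the exponent [3n] yields the conjugate Jacobi
    sum. *)
Let teichE z : z = 0 \/ z ^+ 4 = 1 ->
  teich z = (re z)%:~R + (im z)%:~R * I /\ teich z ^+ 3 = (re z)%:~R - (im z)%:~R * I.
Proof.
have [[r0 r1 rN1 ri rNi] [m0 m1 mN1 mi mNi]] := valE.
have I3 : I ^+ 3 = - I by rewrite exprS I_sqr mulrN1.
case/quartic => [->|->|->|[]->].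
- by rewrite r0 m0 teich0 mul0r addr0 subr0 expr0n.
- by rewrite r1 m1 teich1 mul0r addr0 subr0 expr1n.
- by rewrite rN1 mN1 teichN1 mul0r addr0 subr0; split=> //; ring.
- by rewrite ri mi -/I I3; split; ring.
- by rewrite rNi mNi teichN -/I; split; [ring | rewrite exprNn I3; ring].
Qed.

Let pow_n (x : 'F_p) : x ^+ n = 0 \/ (x ^+ n) ^+ 4 = 1.
Proof.
have [->|x0] := eqVneq x 0; [left | right].
  by rewrite expr0n gtn_eqF.
by rewrite -exprM mulnC -p1E Fp_expp1.
Qed.

Let pow_2n (x : 'F_p) : [\/ x ^+ (2 * n) = 0, x ^+ (2 * n) = 1 | x ^+ (2 * n) = -1].
Proof.
have [->|x0] := eqVneq x 0; first by constructor 1; rewrite expr0n gtn_eqF ?muln_gt0.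
have /eqP : (x ^+ (2 * n)) ^+ 2 = 1.
  by rewrite -exprM mulnAC -p1E Fp_expp1.
by rewrite sqrf_eq1 => /orP[] /eqP->; [constructor 2 | constructor 3].
Qed.

Let a : int := \sum_(x : 'F_p) re (x ^+ n) * re ((1 - x) ^+ (2 * n)).
Let b : int := \sum_(x : 'F_p) im (x ^+ n) * re ((1 - x) ^+ (2 * n)).

Let teich_2n x : teich x ^+ (2 * n) = (re (x ^+ (2 * n)))%:~R.
Proof.
have [[r0 r1 rN1 _ _] _] := valE; rewrite -teichX.
by case: (pow_2n x) => ->; rewrite ?r0 ?r1 ?rN1 ?teich0 ?teich1 ?teichN1.
Qed.

Let jacobi_n : jacobi_sum n = a%:~R + b%:~R * I.
Proof.
rewrite !rmorph_sum mulr_suml -big_split; apply: eq_bigr => x _ /=.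
by rewrite teich_2n -teichX (teichE (pow_n x)).1 !rmorphM /=; ring.
Qed.

Let jacobi_3n : jacobi_sum (3 * n) = a%:~R - b%:~R * I.
Proof.
rewrite !rmorph_sum mulr_suml -sumrB; apply: eq_bigr => x _ /=.
rewrite teich_2n mulnC exprM -teichX (teichE (pow_n x)).2 !rmorphM /=; ring.
Qed.

Let small_eq0 (z : int) : z%:~R = 0 :> R -> `|z| < (p ^ 2)%N%:Z -> z = 0.
Proof.
move=> /injR dv lt; apply/eqP; rewrite -absz_eq0; apply/negPn/negP; rewrite -lt0n => z0.
move: dv; rewrite /dvdz /= => /(dvdn_leq z0); lia.
Qed.

(** Each [x] contributes at most [1] and [x = 0] nothing. This keeps [a^2 + b^2] below [p^2]. *)
Let norm_ab : `|a| + `|b| <= p.-1%:Z.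
Proof.
have [[r0 r1 rN1 ri rNi] [m0 m1 mN1 mi mNi]] := valE.
apply: (@le_trans _ _ (\sum_(x : 'F_p | x != 0) 1)); last first.
  by rewrite sumr_const cardC1 card_Fp // natz.
rewrite (@le_trans _ _ (\sum_(x : 'F_p) (`|re (x ^+ n)| + `|im (x ^+ n)|))) //.
  rewrite big_split lerD //; apply: le_trans (ler_norm_sum _ _ _) _;
    apply: ler_sum => x _.
    rewrite normrM ler_piMr //.
    by case: (pow_2n (1 - x)) => ->; rewrite ?r0 ?r1 ?rN1.
  rewrite normrM ler_piMr //.
  by case: (pow_2n (1 - x)) => ->; rewrite ?r0 ?r1 ?rN1.
rewrite (bigD1 0) //= expr0n gtn_eqF // r0 m0 normr0 !add0r; apply: ler_sum => x _.
by case: (quartic (pow_n x)) => [->|->|->|[]->];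
  rewrite ?r0 ?r1 ?rN1 ?ri ?rNi ?m0 ?m1 ?mN1 ?mi ?mNi.
Qed.

Let sqr_ab : a ^+ 2 + b ^+ 2 = p.
Proof.
have ab := norm_ab; have p1 := prime_gt1 p_pr.
apply/eqP; rewrite -subr_eq0; apply/eqP; apply: small_eq0; last first.
  rewrite -(real_normK (num_real a)) -(real_normK (num_real b)).
  move: ab (normr_ge0 a) (normr_ge0 b); move: `|a| `|b| => x y xy x0 y0.
  have : x ^+ 2 + y ^+ 2 <= p.-1%:Z ^+ 2 by nia.
  by rewrite ltr_norml -!mulnn; nia.
rewrite rmorphB rmorphD !rmorphXn /= -[p%:~R]/P -jacobi_sum_mul jacobi_n jacobi_3n.
transitivity ((b%:~R ^+ 2) * (1 + I ^+ 2)); first by ring.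
by rewrite I_sqr subrr mulr0.
Qed.

Let norm_re z : `|re z| <= 1.
Proof. by rewrite /re; case: (z == 1); case: (z == -1). Qed.

Let sum_re_2n : \sum_(x : 'F_p) re (x ^+ (2 * n)) = 0.
Proof.
apply: small_eq0.
  rewrite rmorph_sum /=; under eq_bigr => x _ do rewrite -teich_2n.
  by rewrite [LHS]teich_psum_eq0 // p1E gtnNdvd //; lia.
apply: (@le_lt_trans _ _ p%:Z); last first.
  by have := prime_gt1 p_pr; rewrite -mulnn; nia.
apply: le_trans (ler_norm_sum _ _ _) _.
apply: (@le_trans _ _ (\sum_(x : 'F_p) 1)); first by apply: ler_sum.
by rewrite sumr_const card_Fp // natz.
Qed.

(** A fourth root of unity satisfies [2 (re z)^2 = 1 + re (z^2)], and the second term sums to zero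
    by [sum_re_2n]. *)
Let sum_re_sqr : \sum_(x : 'F_p) re (x ^+ n) ^+ 2 = 2 * n%:Z.
Proof.
have [[r0 r1 rN1 ri rNi] _] := valE.
suff : 2 * \sum_(x : 'F_p) re (x ^+ n) ^+ 2 = 4 * n%:Z by lia.
rewrite -[RHS]addr0 -[X in _ + X]sum_re_2n mulr_sumr (bigD1 0) //=.
rewrite [X in _ = _ + X](bigD1 0) //= !expr0n !gtn_eqF ?muln_gt0 // r0 !add0r.
have -> : 4 * n%:Z = \sum_(x : 'F_p | x != 0) 1.
  by rewrite sumr_const cardC1 card_Fp // p1E natz; lia.
rewrite -big_split; apply: eq_bigr => x x0 /=.
rewrite [(2 * n)%N]mulnC exprM; have xn0 : x ^+ n != 0 by rewrite expf_neq0.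
case: (quartic (pow_n x)) xn0 => [->|->|->|[]->]; rewrite ?eqxx // => _;
  by rewrite ?sqrrN ?i0_sqr ?expr1n ?r1 ?rN1 ?ri ?rNi.
Qed.

(** Modulo [2] the quadratic character of [1 - x] is [1] for [x != 1], and [re z = (re z)^2]; so [a]
    is congruent to [2n] less the term of [x = 1]. *)
Let a_odd : ~~ (2 %| a)%Z.
Proof.
have [[r0 r1 rN1 ri rNi] _] := valE.
have dv : (2 %| a - 2 * n%:Z + 1)%Z.
  have -> : a - 2 * n%:Z + 1 = \sum_(x : 'F_p | x != 1)
      (re (x ^+ n) * re ((1 - x) ^+ (2 * n)) - re (x ^+ n) ^+ 2).
    rewrite sumrB -sum_re_sqr /a (bigD1 1) //= [X in _ - X](bigD1 1) //=.
    by rewrite subrr expr0n gtn_eqF ?muln_gt0 // expr1n r0 r1; ring.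
  apply: rpred_sum => x x1.
  have : (1 - x) ^+ (2 * n) != 0 by rewrite expf_neq0 // subr_eq0 eq_sym.
  case: (pow_2n (1 - x)) => ->; rewrite ?eqxx // => _; rewrite ?r1 ?rN1;
    by case: (quartic (pow_n x)) => [->|->|->|[]->]; rewrite ?r0 ?r1 ?rN1 ?ri ?rNi.
apply/negP => /dvdzP[c cE]; case/dvdzP: dv => d; rewrite cE; lia.
Qed.

Lemma jacobi_two_squares :
  exists a b : int, exists I : R,
    [/\ I ^+ 2 = -1, a ^+ 2 + b ^+ 2 = p, ~~ (2 %| a)%Z,
        jacobi_sum n = a%:~R + b%:~R * I & jacobi_sum (3 * n) = a%:~R - b%:~R * I].
Proof. by exists a, b, I. Qed.

End SumOfTwoSquares.

End Teichmuller.

(** * Square roots of [-1] and conjugate power sums *)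

Lemma exists_sqrtN1 (p n : nat) :
  prime p -> p = (4 * n).+1 -> exists i0 : 'F_p, i0 ^+ 2 = -1.
Proof.
move=> p_pr pE; have p1 := prime_gt1 p_pr.
have [|g g0 gk] := @Fp_expr_neq1 p p_pr (2 * n).
  by rewrite pE /= gtnNdvd //; lia.
exists (g ^+ n); apply/eqP; rewrite -exprM mulnC.
have /eqP : (g ^+ (2 * n)) ^+ 2 = 1.
  by rewrite -exprM mulnAC -[(4 * n)%N]/((4 * n).+1.-1) -pE Fp_expp1.
by rewrite sqrf_eq1 (negPf gk).
Qed.

(** One integer serves all rings, by the recurrence [u(k+2) = 2a u(k+1) - (a^2 + b^2) u(k)]: it
    links [Z/p^2] with the complex numbers. *)
Lemma conj_power_sum_int (a b : int) (k : nat) :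
  exists s : int, forall (S : comNzRingType) (I : S), I ^+ 2 = -1 ->
    (a%:~R + b%:~R * I) ^+ k + (a%:~R - b%:~R * I) ^+ k = s%:~R.
Proof.
suff [s [t [hs _]]] : exists s t : int,
    (forall (S : comNzRingType) (I : S), I ^+ 2 = -1 ->
      (a%:~R + b%:~R * I) ^+ k + (a%:~R - b%:~R * I) ^+ k = s%:~R) /\
    (forall (S : comNzRingType) (I : S), I ^+ 2 = -1 ->
      (a%:~R + b%:~R * I) ^+ k.+1 + (a%:~R - b%:~R * I) ^+ k.+1 = t%:~R).
  by exists s.
elim: k => [|k [s [t [hs ht]]]].
  exists 2, (2 * a); split=> S I _; first by rewrite !expr0.
  by rewrite !expr1 rmorphM /=; ring.
exists t, (2 * a * t - (a * a + b * b) * s); split=> // S I I2.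
rewrite !(rmorphB, rmorphD, rmorphM) /= -(hs S I I2) -(ht S I I2).
have -> : b%:~R * b%:~R = - ((b%:~R * I) ^+ 2) :> S.
  by rewrite exprMn I2 mulrN1 opprK.
by rewrite !exprS; ring.
Qed.

(** * The congruence in [Z/p^2], by the class of [p] modulo [4] *)

Section ZmodPrimeSquare.
Variable p : nat.
Hypothesis p_pr : prime p.
Local Notation Zpp := 'Z_(p ^ 2).

Let psq_gt1 : (1 < p ^ 2)%N.
Proof. by have := prime_gt1 p_pr; rewrite -mulnn; nia. Qed.

Lemma Zpp_natr_eq0 (k : nat) : (k%:R == 0 :> Zpp) = (p ^ 2 %| k)%N.
Proof. by rewrite -val_eqE /= val_Zp_nat. Qed.

Lemma Zpp_psq : p%:R * p%:R = 0 :> Zpp.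
Proof. by apply/eqP; rewrite -natrM Zpp_natr_eq0 mulnn. Qed.

Lemma Zpp_unit (k : nat) : coprime p k -> k%:R \is a @GRing.unit Zpp.
Proof. by move=> co; rewrite unitZpE // coprimeXl. Qed.

Lemma Zpp_intr_eq0 (z : int) : z%:~R = 0 :> Zpp -> ((p ^ 2)%N %| z)%Z.
Proof.
rewrite /dvdz /=; case: z => k /eqP; first by rewrite /= Zpp_natr_eq0.
by rewrite NegzE rmorphN oppr_eq0 /= Zpp_natr_eq0.
Qed.

End ZmodPrimeSquare.

Lemma Apery_mod_psq_1mod4 (p n r : nat) :
  prime p -> p = (4 * n).+1 -> (0 < r)%N ->
  exists a b : int, [/\ a ^+ 2 + b ^+ 2 = p, ~~ (2 %| a)%Z &
    forall s : int,
      (forall (S : comNzRingType) (I : S), I ^+ 2 = -1 ->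
        (a%:~R + b%:~R * I) ^+ (2 * r) + (a%:~R - b%:~R * I) ^+ (2 * r) = s%:~R) ->
      ((p ^ 2)%N %| (Apery ((p ^ r - 1) %/ 2))%:Z - s)%Z].
Proof.
move=> p_pr pE r0; have p1 := prime_gt1 p_pr.
have [i0 i0E] := exists_sqrtN1 p_pr pE.
have [a [b [I [I2 abE a_odd jn j3n]]]] := jacobi_two_squares p_pr
  (Zpp_psq p_pr) (Zpp_unit p_pr) pE (Zpp_intr_eq0 p_pr) i0E.
exists a, b; split=> // s /(_ _ _ I2) sE; apply: Zpp_intr_eq0 => //.
rewrite rmorphB /= -sE -jn -j3n ![_ ^+ (2 * r)]exprM.
(* [jacobi_sum n] has square zero and [r > 0], so its power drops out. *)
rewrite (jacobi_sum_n_sqr p_pr (Zpp_psq p_pr) (Zpp_unit p_pr) pE) expr0n gtn_eqF //.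
rewrite add0r (jacobi_sum_3n_sqr p_pr (Zpp_psq p_pr) (Zpp_unit p_pr) pE); last by lia.
rewrite -(Apery_iter_half p_pr (Zpp_psq p_pr) (Zpp_unit p_pr) (m := 2 * n)).
- exact: subrr.
- by lia.
- by lia.
Qed.

Lemma Apery_mod_psq_3mod4 (p n r : nat) :
  prime p -> p = (4 * n + 3)%N -> (5 <= p)%N -> (0 < r)%N ->
  (p ^ 2 %| Apery ((p ^ r - 1) %/ 2))%N.
Proof.
move=> p_pr pE p5 r0; rewrite -Zpp_natr_eq0 //.
have pm : p = (2 * (2 * n).+1).+1 by lia.
rewrite (Apery_iter_half p_pr (Zpp_psq p_pr) (Zpp_unit p_pr) pm) //.
rewrite (Apery_half_odd p_pr (Zpp_psq p_pr) (Zpp_unit p_pr) pm) //; last first.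
  by rewrite /= oddM.
by rewrite expr0n gtn_eqF.
Qed.

(** * Comparison with the coefficient of the CM newform *)

Theorem theorem1p9 (R : realType)
  (h : nat -> R[i] -> R[i]) (alpha : nat -> nat -> R[i])
  (hk : forall k : nat, (2 <= k)%N -> is_h k (h k) (alpha k))
  (p r : nat) (p_prime : prime p) (p_ge5 : (5 <= p)%N) (r_ge1 : (1 <= r)%N) :
  congruent_mod (p ^ 2)%N
    (Apery ((p ^ r - 1) %/ 2)%N)%:R (alpha (2 * r + 1)%N p).
Proof.
have p_odd : odd p by case: (even_prime p_prime) => // p2; move: p_ge5; rewrite p2.
have [|_ _ cm] := hk (2 * r + 1)%N; first by lia.
have [cm1 cm3] := cm p p_prime p_odd.
have pmod : (p %% 4 = 1 \/ p %% 4 = 3)%N by lia.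
case: pmod => pmod; last first.
  rewrite (cm3 pmod) /congruent_mod subr0.
  have pE : p = (4 * (p %/ 4) + 3)%N by lia.
  have /dvdnP[c cE] := Apery_mod_psq_3mod4 p_prime pE p_ge5 r_ge1.
  by exists c%:Z; rewrite cE -PoszM.
have pE : p = (4 * (p %/ 4)).+1 by lia.
have [a [b [abE a_odd main]]] := Apery_mod_psq_1mod4 p_prime pE r_ge1.
have [s sE] := conj_power_sum_int a b (2 * r).
have /dvdzP[c cE] := main s sE.
exists c; rewrite (cm1 pmod a b (esym abE) a_odd) -cE.
have [u uE] : exists u, a = 2 * u + 1 by exists (a %/ 2)%Z; move: a_odd; lia.
(* [a] and [p = a^2 + b^2] are odd, so [b] is even. *)
have [v vE] : exists v, b = 2 * v.
  exists (b %/ 2)%Z; have [w [bE|bE]] : exists w, b = 2 * w \/ b = 2 * w + 1.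
    by exists (b %/ 2)%Z; lia.
  - by rewrite bE mulKz.
  - by move: abE; rewrite uE bE !expr2 => abE; lia.
(* The weight minus one is [2r], so the sign exponent is even and the sign is [1]. *)
have -> : (((a + b - 1) * ((2 * r + 1)%N%:Z - 1)) %/ 2)%Z = 2 * ((u + v) * r%:Z).
  rewrite [X in (X %/ 2)%Z](_ : _ = 2 * ((u + v) * r%:Z) * 2) ?mulzK //.
  by rewrite uE vE PoszD PoszM; ring.
rewrite -exprz_exp -[(-1) ^ 2]/((-1) ^+ 2) sqrrN expr1n exp1rz mul1r addnK rmorphB /=.
(* The integer [s], used above in [Z/p^2], is now evaluated at the complex number [i]. *)
congr (_ - _); rewrite -(sE R[i] 'i%C (sqr_i R)).
have reE (z : int) : z%:~R = (z%:~R : R)%:C%C by rewrite rmorph_int.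
by rewrite !reE; congr (_ ^+ _ + _ ^+ _); simpc.
Qed.
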